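(* For every positive integer $m$, as formal power series in $u,z_1,z_2,\ldots$, \[1+\sum_{n\ge1}u^n\sum_{\pi\in S_n}x_m(\pi)\prod_{i\ge1}z_i^{N_i(\pi)}=\frac{1}{1-z_1u/(2m+1)}\prod_{i\ge1}\left(\frac{1+z_iu^i/(2m+1)^i}{1-z_iu^i/(2m+1)^i}\right)^{f_{i,m}}.\]
   Context: $N_i(\pi)$ is the number of $i$-cycles of $\pi$. $f_{i,m}=\frac{1}{2i}\sum_{d\mid i,\ d\text{ odd}}\mu(d)\,[(2m+1)^{i/d}-1]$, with $\mu$ the Möbius function. $x_m$ is the lazy $m$-shelf shuffling distribution on $S_n$: a deck of cards $1,\ldots,n$ (top to bottom) is processed in order $1,\ldots,n$; each card independently and uniformly chooses one of $2m+1$ options: shelf $0$ (placed below the cards already there), or one of shelves $1,\ldots,m$, placed either on top of or below the cards already there. The piles are then stacked with shelf $0$ on top, then shelf $1$, ..., shelf $m$; $x_m(\pi)$ is the probability that the card in position $i$ from the top is $\pi(i)$ for all $i$. *)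

(* Defs.v *)
From HB Require Import structures.
From mathcomp Require Import all_boot all_order all_algebra all_fingroup.
From mathcomp Require Import mpoly.
Set Implicit Arguments. Unset Strict Implicit. Unset Printing Implicit Defensive.
Import Order.TTheory GRing.Theory Num.Theory.
Local Open Scope ring_scope.

Definition moebius (n : nat) : int :=
  if n == 0%N then 0
  else if all (fun p => logn p n == 1%N) (primes n) then (-1) ^+ size (primes n)
  else 0.

Definition fim (i m : nat) : rat :=
  (i.*2)%:R^-1 *
  \sum_(d <- divisors i | odd d)
      (moebius d)%:~R * (((m.*2.+1) ^ (i %/ d))%:R - 1).

Definition ncycles (n : nat) (s : 'S_n) (i : nat) : nat :=
  #|[set C in porbits s | #|C| == i]|.

(* Cards are 'I_n (card c stands for card c+1), processed in increasing order.
   Each card chooses an option o : 'I_(2m+1):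
     o = 0      : shelf 0, placed below the cards already there;
     o = 2j-1   : shelf j (1<=j<=m), placed on top;
     o = 2j     : shelf j (1<=j<=m), placed below.
   So the shelf of o is (o+1)/2 and the card goes on top iff o is odd. *)
Definition opt_shelf (o : nat) : nat := o.+1./2.
Definition opt_top (o : nat) : bool := odd o.

Definition shelf_pile (n m : nat) (w : {ffun 'I_n -> 'I_(m.*2.+1)}) (j : nat)
  : seq 'I_n :=
  foldl (fun s c => if opt_shelf (w c) == j then
                      (if opt_top (w c) then c :: s else rcons s c)
                    else s) [::] (enum 'I_n).

(* final deck, top to bottom: shelf 0, then shelf 1, ..., shelf m *)
Definition shelf_deck (n m : nat) (w : {ffun 'I_n -> 'I_(m.*2.+1)}) : seq 'I_n :=
  flatten [seq shelf_pile w j | j <- iota 0 m.+1].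

Definition xm (m n : nat) (pi : 'S_n) : rat :=
  #|[set w : {ffun 'I_n -> 'I_(m.*2.+1)} |
       shelf_deck w == [seq pi i | i <- enum 'I_n]]|%:R
  / ((m.*2.+1) ^ n)%:R.

(* ---------- truncated formal power series ----------
   We work in {poly {mpoly rat[N]}}: polynomials in u whose coefficients are
   polynomials in z_1..z_N, where z_(k+1) is the mpoly variable 'X_k (k : 'I_N).
   Both sides are compared modulo u^(N+1) (take_poly N.+1), for every N. *)

Notation PS N := {poly {mpoly rat[N]}}.

Definition cst (N : nat) (c : rat) : PS N := (c%:MP)%:P.

Definition gbinom (r : rat) (k : nat) : rat :=
  (\prod_(j < k) (r - j%:R)) / (k`!)%:R.

Definition geom_tr (N : nat) (a : PS N) : PS N := \sum_(j < N.+1) a ^+ j.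

(* truncated ((1+a)/(1-a))^r = (1+a)^r (1-a)^(-r) via binomial series *)
Definition ratpow_tr (N : nat) (r : rat) (a : PS N) : PS N :=
  (\sum_(j < N.+1) cst N (gbinom r j) * a ^+ j) *
  (\sum_(j < N.+1) cst N (gbinom (- r) j) * (- a) ^+ j).

Definition aterm (N m : nat) (k : 'I_N) : PS N :=
  (((m.*2.+1)%:R : rat) ^- k.+1 *: 'X_k)%:P * 'X ^+ k.+1.

Definition lhs_tr (N m : nat) : PS N :=
  1 + \sum_(1 <= n < N.+1)
        'X ^+ n * (\sum_(pi : 'S_n)
                     (xm m pi)%:MP * \prod_(k < N) 'X_k ^+ ncycles pi k.+1)%:P.

(* 1/(1 - z_1 u/(2m+1)) * prod_(i>=1) ((1+a_i)/(1-a_i))^(f_{i,m}),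
   truncated; the first factor is geom_tr (aterm k) for k = 0 (i.e. a_1), which
   exists only when N > 0 (for N = 0 everything is 1 mod u). Factors with
   i > N are 1 mod u^(N+1) and are omitted. *)
Definition rhs_tr (N m : nat) : PS N :=
  take_poly N.+1
    ((\prod_(k < N | val k == 0%N) geom_tr (aterm m k)) *
     \prod_(k < N) ratpow_tr (fim k.+1 m) (aterm m k)).

(* Main.v *)
(** Sorting the cards by the option they choose, the cards of an odd option in
    decreasing order and those of an even option in increasing order, gives the
    deck; so [pi] is monotone on each block of positions with a common option.
    Attach to a position the periodic sequence of options read along its cycle.
    Positions are then weakly increasing for the lexicographic order twisted by
    the parity of the letters, and the word of choices is recovered from the
    multiset of sequences.  As in the Gessel-Reutenauer bijection, words of
    length [n] thus correspond to multisets of primitive necklaces of total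
    length [n].  Over a necklace of length [k] and multiplicity [c] the map
    [pi^k] acts on [c] points, increasingly if the necklace has an even number
    of odd letters and decreasingly otherwise.  In the first case it is the
    identity, giving [c] cycles of length [k]; in the second it is the reversal,
    giving [c./2] cycles of length [2k] and [odd c] of length [k].  Hence the
    generating function is
      [\prod_even 1 / (1 - a_k) * \prod_odd (1 + a_k) / (1 - a_2k)],
    where [a_k = z_k u^k / (2m+1)^k].  With [E_k] even and [O_k] odd primitive
    necklaces of length [k], Moebius inversion over odd divisors gives
    [O_k = f_(k,m)], and counting words with signs gives
    [E_k + O_(k/2) = O_k + (k == 1)], which is the product in the theorem. *)

Require Import Defs.
From HB Require Import structures.
From mathcomp Require Import all_boot all_order all_algebra all_fingroup.
From mathcomp Require Import mpoly zify ring.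
Set Implicit Arguments. Unset Strict Implicit. Unset Printing Implicit Defensive.
Import Order.TTheory GRing.Theory Num.Theory.
(** * The deck permutation *)

Lemma pairwise_rev (T : Type) (r : rel T) (s : seq T) :
  pairwise r (rev s) = pairwise (fun x y => r y x) s.
Proof. by elim: s => //= x s IHs; rewrite rev_cons pairwise_rcons all_rev IHs. Qed.

Section Deck.
Variables (n m : nat).
Implicit Types (w : {ffun 'I_n -> 'I_(m.*2.+1)}) (pi : 'S_n) (c : 'I_n).

(** The order of the cards down the finished deck. On shelf [j] the cards of option [2j - 1] (on
    top) lie above those of [2j] (below), so options increase down the deck; cards put on top come
    out in reverse order. *)
Definition before w c c' : bool :=
  (w c < w c') || (w c == w c') && (if odd (w c) then c' < c else c < c').

Lemma before_irr w : irreflexive (before w).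
Proof. by move=> c; rewrite /before !ltnn eqxx; case: odd. Qed.

Lemma foldl_pileE w j s l :
  foldl (fun s c => if opt_shelf (w c) == j then
                      (if opt_top (w c) then c :: s else rcons s c)
                    else s) s l =
  rev [seq c <- l | (opt_shelf (w c) == j) && odd (w c)] ++ s ++
  [seq c <- l | (opt_shelf (w c) == j) && ~~ odd (w c)].
Proof.
elim: l s => [|c l IHl] s /=; first by rewrite cats0.
rewrite {}IHl /opt_top; case: eqP => //= _; case: odd => //=.
  by rewrite rev_cons cat_rcons.
by rewrite cat_rcons.
Qed.

Lemma pairwise_ltn_enum : pairwise (fun c c' : 'I_n => c < c') (enum 'I_n).
Proof.
have := pairwise_map val ltn (enum 'I_n); rewrite val_enum_ord => <-.
by rewrite -sorted_pairwise ?iota_ltn_sorted //; apply: ltn_trans.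
Qed.

Lemma shelf_pileE w j :
  shelf_pile w j =
  rev [seq c <- enum 'I_n | (opt_shelf (w c) == j) && odd (w c)] ++
  [seq c <- enum 'I_n | (opt_shelf (w c) == j) && ~~ odd (w c)].
Proof. by rewrite /shelf_pile foldl_pileE. Qed.

Lemma mem_shelf_pile w j c : (c \in shelf_pile w j) = (opt_shelf (w c) == j).
Proof.
rewrite shelf_pileE mem_cat mem_rev mem_filter mem_enum mem_filter mem_enum.
rewrite !andbT -andb_orr.
by case: odd; rewrite andbT.
Qed.

Lemma mem_shelf_deck w c : c \in shelf_deck w.
Proof.
apply/flattenP; exists (shelf_pile w (opt_shelf (w c))).
  apply: map_f; rewrite mem_iota add0n /opt_shelf /=.
  by have := ltn_ord (w c); lia.
by rewrite mem_shelf_pile.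
Qed.

Lemma pairwise_shelf_pile w j : pairwise (before w) (shelf_pile w j).
Proof.
rewrite shelf_pileE pairwise_cat; apply/and3P; split.
- apply/allrelP => c c'; rewrite mem_rev !mem_filter /opt_shelf /before.
  move=> /andP[/andP[/eqP h1 h2] _] /andP[/andP[/eqP h3 h4] _].
  by apply/orP; left; lia.
- rewrite pairwise_rev.
  have : pairwise (fun c c' : 'I_n => c < c')
    [seq c <- enum 'I_n | (opt_shelf (w c) == j) && odd (w c)].
    exact/pairwise_filter/pairwise_ltn_enum.
  apply: sub_in_pairwise (filter_all _ _) => c c' /= /andP[/eqP h1 h2].
  move=> /andP[/eqP h3 h4] lt_cc'; rewrite /before /opt_shelf in h1 h3 *.
  have -> : w c' = w c by apply/val_inj => /=; lia.
  by rewrite ltnn eqxx h2.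
have : pairwise (fun c c' : 'I_n => c < c')
    [seq c <- enum 'I_n | (opt_shelf (w c) == j) && ~~ odd (w c)].
  exact/pairwise_filter/pairwise_ltn_enum.
apply: sub_in_pairwise (filter_all _ _) => c c' /= /andP[/eqP h1 h2].
move=> /andP[/eqP h3 h4] lt_cc'; rewrite /before /opt_shelf in h1 h3 *.
have -> : w c' = w c by apply/val_inj => /=; lia.
by rewrite ltnn eqxx (negbTE h2).
Qed.

Lemma pairwise_shelf_deck w : pairwise (before w) (shelf_deck w).
Proof.
rewrite /shelf_deck; elim: m.+1 0 => [|k IHk] j //=.
rewrite pairwise_cat pairwise_shelf_pile IHk !andbT.
apply/allrelP => c c'; rewrite mem_shelf_pile => /eqP h1 /flattenP[s].
case/mapP => i; rewrite mem_iota => /andP[hi _] ->; rewrite mem_shelf_pile => /eqP h2.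
by rewrite /before; apply/orP; left; move: h1 h2; rewrite /opt_shelf; lia.
Qed.

(** Every card is in the deck, and none occurs twice because [before] is irreflexive and holds
    pairwise. *)
Lemma shelf_deck_perm w :
  exists pi, shelf_deck w = [seq pi i | i <- enum 'I_n].
Proof.
have : perm_eq (shelf_deck w) (ord_tuple n).
  apply: uniq_perm; [|exact: enum_uniq|].
    exact: pairwise_uniq (@before_irr w) (pairwise_shelf_deck w).
  by move=> c; rewrite mem_shelf_deck mem_enum.
case/tuple_permP => pi ->; exists pi; rewrite /=.
by apply: eq_map => i; rewrite tnth_ord_tuple.
Qed.

Definition deck_perm w : 'S_n :=
  odflt 1%g [pick pi : 'S_n | shelf_deck w == [seq pi i | i <- enum 'I_n]].

Lemma deck_permE w : shelf_deck w = [seq deck_perm w i | i <- enum 'I_n].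
Proof.
rewrite /deck_perm; case: pickP => [pi /eqP //|none].
by have [pi /eqP] := shelf_deck_perm w; rewrite none.
Qed.

Lemma deck_permP w pi :
  (shelf_deck w == [seq pi i | i <- enum 'I_n]) = (pi == deck_perm w).
Proof.
rewrite deck_permE; apply/eqP/eqP => [/eq_in_map h|-> //].
by apply/permP => i; rewrite h // mem_enum.
Qed.

Lemma before_deck_perm w (p p' : 'I_n) :
  p < p' -> before w (deck_perm w p) (deck_perm w p').
Proof.
move=> lt_pp'; have := pairwise_shelf_deck w; rewrite deck_permE.
move/(pairwiseP (deck_perm w p)) => /(_ p p'); rewrite !inE size_map size_enum_ord.
move=> /(_ (ltn_ord p) (ltn_ord p') lt_pp').
have nthE (i : 'I_n) :
    nth (deck_perm w p) [seq deck_perm w i | i <- enum 'I_n] i = deck_perm w i.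
  by rewrite (nth_map i) ?size_enum_ord // nth_ord_enum.
by rewrite !nthE.
Qed.

End Deck.

(** * Periodic words and the signed lexicographic order *)

Section Words.
Variables (q K : nat).
Local Notation X := {ffun 'I_K.+1 -> 'I_q.+1}.
Implicit Types (x y : X).

(** Words of length [K.+1] stand for sequences of that period. With [K.+1] a common multiple of all
    cycle lengths, this finite type holds every itinerary. *)
Definition ext x (t : nat) : 'I_q.+1 := x (inord (t %% K.+1)).

Lemma extP x y : ext x =1 ext y -> x = y.
Proof.
move=> exy; apply/ffunP => i; have := exy i.
by rewrite /ext modn_small ?ltn_ord // inord_val.
Qed.

Lemma ext_ffun (f : nat -> 'I_q.+1) t :
  (forall s, f (s + K.+1) = f s) -> ext [ffun i : 'I_K.+1 => f i] t = f t.
Proof.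
move=> f_per; rewrite /ext ffunE inordK ?ltn_pmod // {2}(divn_eq t K.+1).
elim: (t %/ K.+1) => [|k IHk]; first by rewrite mul0n.
by rewrite mulSn -addnA addnC f_per.
Qed.

Definition shift_fun x : X := [ffun i => x (ordS i)].

Lemma shift_fun_inj : injective shift_fun.
Proof.
move=> x y /ffunP eqS; apply/ffunP => i; have := eqS (ord_pred i).
by rewrite !ffunE ord_predK.
Qed.

Definition shift : {perm X} := perm shift_fun_inj.

Lemma ext_shift x t : ext (shift x) t = ext x t.+1.
Proof.
rewrite /ext permE ffunE; congr (x _); apply/val_inj => /=.
by rewrite !inordK ?ltn_pmod // -addn1 modnDml addn1.
Qed.

Lemma ext_shiftX x k t : ext ((shift ^+ k)%g x) t = ext x (t + k).
Proof.
elim: k t => [|k IHk] t; first by rewrite expg0 perm1 addn0.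
by rewrite expgSr permM ext_shift IHk addSnnS.
Qed.

Definition letter x := ext x 0.

(* The kneading order: the deck permutation reverses the order of the cards
   that choose an odd option, so each odd letter reverses the comparison of
   what follows. *)
Fixpoint slex (d : nat) x y : bool :=
  if d is d'.+1 then
    (letter x < letter y) ||
    (letter x == letter y) &&
      (if odd (letter x) then slex d' (shift y) (shift x)
       else slex d' (shift x) (shift y))
  else false.

Lemma slex_irr d : irreflexive (slex d).
Proof. by elim: d => //= d IHd x; rewrite ltnn eqxx !IHd; case: odd. Qed.

Lemma slex_trans d : transitive (slex d).
Proof.
elim: d => //= d IHd y x z.
case/orP=> [lt_xy|/andP[/eqP eq_xy hxy]] /orP[lt_yz|/andP[/eqP eq_yz hyz]].
- by rewrite (ltn_trans lt_xy lt_yz).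
- by rewrite -eq_yz lt_xy.
- by rewrite eq_xy lt_yz.
rewrite eq_xy eq_yz ltnn eqxx /=; rewrite eq_xy eq_yz in hxy; rewrite eq_yz in hyz.
by case: odd hxy hyz => hxy hyz; [apply: IHd hyz hxy | apply: IHd hxy hyz].
Qed.

Lemma slexS d x y : slex d x y -> slex d.+1 x y.
Proof.
elim: d x y => // d IHd x y; rewrite [slex d.+2 x y]/= [slex d.+1 x y]/=.
case/orP=> [->//|/andP[eq_xy h]]; apply/orP; right; rewrite eq_xy.
by case: odd h => /IHd.
Qed.

Lemma slex_total d x y :
  (exists2 t, t < d & ext x t != ext y t) -> slex d x y || slex d y x.
Proof.
elim: d x y => [|d IHd] x y [t lt_td neq] //=.
case: (ltngtP (letter x) (letter y)) => //= [_|/val_inj eq_xy]; first by rewrite orbT.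
rewrite eq_xy eqxx /=.
have: slex d (shift x) (shift y) || slex d (shift y) (shift x).
  case: t lt_td neq => [|t] lt_td neq;
    first by rewrite /letter in eq_xy; rewrite eq_xy eqxx in neq.
  by apply: IHd; exists t; rewrite // !ext_shift.
by case: odd => //; rewrite orbC.
Qed.

Lemma slex_neq x y : x != y -> slex K.+1 x y || slex K.+1 y x.
Proof.
move=> neq_xy; apply: slex_total.
have: ~~ [forall i, x i == y i].
  by apply: contra neq_xy => /forallP h; apply/eqP/ffunP => i; apply/eqP.
rewrite negb_forall => /existsP[i neq_i]; exists i => //.
by rewrite /ext modn_small ?ltn_ord // inord_val.
Qed.

(** Distinct words differ within [K.+1] letters, so they are comparable at depth [K.+1]; the wrong
    comparison would contradict the one at depth [K.+2] by transitivity. The fixed depth of [sle]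
    thus survives shifts. *)
Lemma slex_stable x y : slex K.+2 x y -> slex K.+1 x y.
Proof.
move=> lt_xy; have [eq_xy|/slex_neq/orP[//|/slexS lt_yx]] := eqVneq x y.
  by rewrite eq_xy slex_irr in lt_xy.
by have := slex_trans lt_xy lt_yx; rewrite slex_irr.
Qed.

Definition sle x y := (x == y) || slex K.+1 x y.

Lemma sle_refl : reflexive sle. Proof. by move=> x; rewrite /sle eqxx. Qed.

Lemma sle_anti : antisymmetric sle.
Proof.
move=> x y /andP[/orP[/eqP //|lt_xy] /orP[/eqP //|lt_yx]].
by have := slex_trans lt_xy lt_yx; rewrite slex_irr.
Qed.

Lemma sle_trans : transitive sle.
Proof.
move=> y x z /orP[/eqP -> //|lt_xy] /orP[/eqP <-|lt_yz]; rewrite /sle.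
  by rewrite lt_xy orbT.
by rewrite (slex_trans lt_xy lt_yz) orbT.
Qed.

Lemma sle_total : total sle.
Proof.
move=> x y; rewrite /sle; have [->|/slex_neq/orP[] ->] := eqVneq x y => //;
by rewrite ?orbT.
Qed.

Lemma sle_letter x y : letter x < letter y -> sle x y.
Proof. by move=> h; rewrite /sle slex_stable ?orbT //= h. Qed.

(** Comparing the tails to depth [K.+1] compares the words to depth [K.+2], and [slex_stable]
    removes the extra level. *)
Lemma sle_shift x y : letter x = letter y ->
  (if odd (letter x) then sle (shift y) (shift x) else sle (shift x) (shift y)) ->
  sle x y.
Proof.
move=> eq_xy; have [/(@perm_inj _ shift) ->|ne] := eqVneq (shift x) (shift y).
  by move=> _; apply: sle_refl.
rewrite /sle (eq_sym (shift y)) (negbTE ne) !orFb => h.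
apply/orP; right; apply: slex_stable; apply/orP; right; apply/andP; split.
  exact/eqP.
exact: h.
Qed.

End Words.

(** * Itineraries *)

Section Itinerary.
Variables (n m K : nat).
Hypothesis K_dvd : forall k, 0 < k <= n -> k %| K.+1.
Local Notation X := {ffun 'I_K.+1 -> 'I_(m.*2).+1}.
Local Notation word := {ffun 'I_n -> 'I_(m.*2.+1)}.
Implicit Types (w : word) (s : seq X) (p : 'I_n).

Lemma perm_expK (s : 'S_n) : (s ^+ K.+1)%g = 1%g.
Proof.
apply/permP => p; rewrite perm1 permX.
have : #|porbit s p| %| K.+1.
  apply: K_dvd; rewrite lt0n card_porbit_neq0 /=.
  by rewrite -[X in _ <= X]card_ord max_card.
case/dvdnP => j ->; elim: j => //= j IHj.
by rewrite mulSn iterD IHj iter_porbit.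
Qed.

(** The exponent [t.+1] makes the sequence start with the card lying in position [p]: it is the
    option of this card that weakly increases with [p]. *)
Definition itin w p : X := [ffun t : 'I_K.+1 => w ((deck_perm w ^+ t.+1)%g p)].

Lemma ext_itin w p t : ext (itin w p) t = w ((deck_perm w ^+ t.+1)%g p).
Proof.
rewrite /itin (ext_ffun (f := fun t => w ((deck_perm w ^+ t.+1)%g p))) // => r.
by rewrite -addSn expgD perm_expK mulg1.
Qed.

Lemma itin_deck_perm w p : itin w (deck_perm w p) = shift (m.*2) K (itin w p).
Proof.
by apply: extP => t; rewrite ext_shift !ext_itin [in RHS]expgS permM.
Qed.

Lemma letter_itin w p : letter (itin w p) = w (deck_perm w p).
Proof. by rewrite /letter ext_itin expg1. Qed.

Lemma wordE w p : w p = letter ((shift (m.*2) K)^-1%g (itin w p)).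
Proof.
by rewrite -{2}(permKV (deck_perm w) p) itin_deck_perm permK letter_itin permKV.
Qed.

Lemma itin_le w (p p' : 'I_n) : p < p' -> sle (itin w p) (itin w p').
Proof.
(* Induction on a place [t] where the itineraries differ. If the first letters agree, the images of
   the two positions are ordered as the parity of this letter dictates, which is what [sle_shift]
   asks of the tails. *)
have H t : forall p p' : 'I_n, p < p' ->
    ext (itin w p) t != ext (itin w p') t -> sle (itin w p) (itin w p').
  elim: t => [|t IHt] {}p {}p' lt_pp' neq; have := before_deck_perm w lt_pp';
    rewrite /before -!letter_itin; case/orP => [|/andP[/eqP eq_l]];
    do ?exact: sle_letter.
    by rewrite /letter in eq_l; rewrite eq_l eqxx in neq.
  rewrite -!ext_shift -!itin_deck_perm in neq => lt_pi.
  apply: sle_shift => //; rewrite -!itin_deck_perm.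
  by case: odd lt_pi => lt_pi; apply: IHt lt_pi _; rewrite // eq_sym.
move=> lt_pp'.
have [/eqfunP eq_e|] := boolP [forall t : 'I_K.+1, ext (itin w p) t == ext (itin w p') t].
  suff -> : itin w p = itin w p' by exact: sle_refl.
  apply/ffunP => t; have := eq_e t.
  by rewrite /ext !modn_small ?ltn_ord // !inord_val.
by rewrite negb_forall => /existsP[t]; apply: H.
Qed.

Definition itin_seq w : seq X := [seq itin w p | p <- enum 'I_n].

Lemma pairwise_map_enum (T : Type) (r : rel T) (f : 'I_n -> T) :
  (forall p p' : 'I_n, p < p' -> r (f p) (f p')) ->
  pairwise r [seq f p | p <- enum 'I_n].
Proof.
by move=> mono; rewrite pairwise_map; apply: sub_pairwise (pairwise_ltn_enum n).
Qed.

Lemma pairwise_itin_seq w : pairwise (@sle (m.*2) K) (itin_seq w).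
Proof. exact/pairwise_map_enum/itin_le. Qed.

Lemma perm_enum_map (s : 'S_n) : perm_eq [seq s p | p <- enum 'I_n] (enum 'I_n).
Proof.
apply: uniq_perm; [|exact: enum_uniq|].
  by rewrite map_inj_uniq ?enum_uniq //; apply: perm_inj.
move=> p; rewrite mem_enum inE; apply/mapP.
by exists (s^-1%g p); rewrite ?mem_enum ?permKV.
Qed.

(** The deck permutation rearranges the positions and shifts their itineraries. *)
Lemma itin_seq_shift w : perm_eq (map (shift (m.*2) K) (itin_seq w)) (itin_seq w).
Proof.
rewrite /itin_seq -map_comp (eq_map (g := itin w \o deck_perm w)); last first.
  by move=> p /=; rewrite itin_deck_perm.
by rewrite map_comp perm_map // perm_enum_map.
Qed.

(** The sorted arrangement of a multiset is unique, and the option of a card is the letter preceding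
    its itinerary ([wordE]). *)
Lemma itin_seq_inj w w' : perm_eq (itin_seq w) (itin_seq w') -> w = w'.
Proof.
move/(pairwise_eq (@sle_anti _ _) (pairwise_itin_seq w) (pairwise_itin_seq w')).
by move=> /eq_in_map eqV; apply/ffunP => p; rewrite !wordE eqV ?mem_enum.
Qed.

(* The word is forced: its letter at [c] is the one preceding the sequence
   [V c].  That [V] is then the itinerary follows from the uniqueness of the
   sorted arrangement of a multiset. *)
Lemma itin_seq_surj s : size s = n -> pairwise (@sle (m.*2) K) s ->
  perm_eq (map (shift (m.*2) K) s) s -> exists w, itin_seq w = s.
Proof.
move=> sz_s sorted_s perm_s; pose sh := shift (m.*2) K.
pose V (p : 'I_n) := nth [ffun=> ord0] s p.
have VE : [seq V p | p <- enum 'I_n] = s.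
  by rewrite (map_comp (nth _ s) val) val_enum_ord -sz_s; apply: mkseq_nth.
have V_le (p p' : 'I_n) : p < p' -> sle (V p) (V p').
  move=> lt_pp'; move/(pairwiseP [ffun=> ord0]): sorted_s; apply=> //; rewrite inE sz_s //.
pose w : word := [ffun c => letter (sh^-1%g (V c))].
pose U p := sh^-1%g (V (deck_perm w p)).
have UV : U =1 V.
  suff /eq_in_map eqUV : [seq U p | p <- enum 'I_n] = [seq V p | p <- enum 'I_n].
    by move=> p; rewrite eqUV ?mem_enum.
  rewrite VE; apply: (pairwise_eq (@sle_anti _ _)) => //.
    (* [U] is sorted too: its first letters are the options of the cards in deck order, and at equal
       letters its tails are the values of [V] at these cards, ordered with the matching twist. *)
    apply: pairwise_map_enum => p p' /(before_deck_perm w).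
    rewrite /before !ffunE -/(U p) -/(U p') => /orP[|/andP[/eqP eq_l lt_pi]].
      exact: sle_letter.
    apply: sle_shift => //; rewrite /U !permKV.
    by case: odd lt_pi => /V_le.
  rewrite (map_comp sh^-1%g) (map_comp V).
  have: perm_eq (map sh^-1%g (map sh s)) (map sh^-1%g s) by apply: perm_map.
  rewrite -map_comp map_id_in => [|x _ /=]; last by rewrite permK.
  rewrite perm_sym; apply: perm_trans; apply: perm_map.
  by rewrite -VE; apply/perm_map/perm_enum_map.
exists w; rewrite -VE; apply: eq_map => p; apply: extP => t; rewrite ext_itin.
elim: t p => [|t IHt] p; first by rewrite expg1 ffunE -/(U p) UV.
rewrite expgS permM IHt -ext_shift; congr (ext _ t).
by rewrite -(UV p) /U permKV.
Qed.

End Itinerary.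

(** * Orbits and monotone permutations *)

Section PermOrbits.
Variables (T : finType) (s : {perm T}).

Lemma permX_id_mul x a b : (s ^+ a)%g x = x -> (s ^+ (b * a))%g x = x.
Proof.
move=> fix_a; elim: b => [|b IHb]; first by rewrite mul0n expg0 perm1.
by rewrite mulSn expgD permM fix_a.
Qed.

Lemma permX_porbit x : (s ^+ #|porbit s x|)%g x = x.
Proof. by rewrite permX iter_porbit. Qed.

(** If [s ^+ k] fixes [x], so does the power by the remainder of [k] modulo the orbit length, and
    the points of one turn are distinct. *)
Lemma permX_eq_id x k : ((s ^+ k)%g x == x) = (#|porbit s x| %| k).
Proof.
apply/eqP/idP => [|/dvdnP[b ->]]; last exact/permX_id_mul/permX_porbit.
set c := #|porbit s x|; have c_gt0 : 0 < c by rewrite lt0n card_porbit_neq0.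
rewrite [in X in X -> _](divn_eq k c) expgD permM permX_id_mul ?permX_porbit //.
move=> fix_r; have lt_r : k %% c < c by rewrite ltn_pmod.
have := nth_uniq x _ _ (uniq_traject_porbit s x).
move=> /(_ (k %% c) 0); rewrite size_traject => /(_ lt_r c_gt0).
by rewrite !nth_traject //= -permX fix_r eqxx => /esym.
Qed.

Lemma porbit_orbits x C : C \in porbits s -> (porbit s x == C) = (x \in C).
Proof. by case/imsetP => y _ ->; rewrite eq_porbit_mem. Qed.

Lemma big_porbits (R : Type) (idx : R) (op : Monoid.com_law idx)
    (P : pred {set T}) (F : T -> R) :
  \big[op/idx]_(x | P (porbit s x)) F x =
  \big[op/idx]_(C in porbits s | P C) \big[op/idx]_(x in C) F x.
Proof.
rewrite (partition_big (porbit s) (fun C => (C \in porbits s) && P C)) => [|x Px].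
  apply: eq_bigr => C /andP[Cs PC]; apply: eq_bigl => x.
  apply/andP/idP => [[_ /eqP <-]|]; first exact: porbit_id.
  by rewrite -(porbit_orbits x Cs) => /eqP ->; rewrite eqxx.
by rewrite Px andbT; apply: imset_f.
Qed.

Lemma porbit_invariant (R : Type) (F : T -> R) x y :
  (forall z, F (s z) = F z) -> y \in porbit s x -> F y = F x.
Proof.
move=> Finv /porbitP[i ->]; elim: i => [|i IHi]; first by rewrite expg0 perm1.
by rewrite expgSr permM Finv.
Qed.

End PermOrbits.

(** Points, unlike cycles, can be counted separately over each fiber of the itinerary map. *)
Lemma ncyclesE n (s : 'S_n) i :
  i * ncycles s i = #|[set p | #|porbit s p| == i]|.
Proof.
rewrite -sum1dep_card (big_porbits s _ (fun C : {set 'I_n} => #|C| == i)).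
rewrite (eq_bigr (fun=> i)) => [|C /andP[_ /eqP]]; last by rewrite sum1_card.
by rewrite sum_nat_cond_const mulnC.
Qed.

(** The iterates of a moved point would be strictly monotone, hence travel further than ['I_n]
    allows. *)
Lemma increasing_perm_id n (F : {set 'I_n}) (t : 'S_n) :
  (forall p, p \in F -> t p \in F) ->
  (forall p p' : 'I_n, p \in F -> p' \in F -> p < p' -> t p < t p') ->
  forall p, p \in F -> t p = p.
Proof.
move=> F_stable incr p Fp.
have FX i : (t ^+ i)%g p \in F.
  by elim: i => [|i IHi]; rewrite ?expg0 ?perm1 // expgSr permM F_stable.
case: (ltngtP (t p) p) => [lt|lt|/val_inj //].
  have dec i : (t ^+ i.+1)%g p < (t ^+ i)%g p.
    elim: i => [|i IHi]; first by rewrite expg1 expg0 perm1.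
    by rewrite (expgSr t i.+1) permM [in X in _ < X](expgSr t i) permM incr.
  have le i : (t ^+ i)%g p + i <= p.
    elim: i => [|i IHi]; first by rewrite expg0 perm1 addn0.
    by have := dec i; lia.
  by have := le n; have := ltn_ord p; lia.
have inc i : (t ^+ i)%g p < (t ^+ i.+1)%g p.
  elim: i => [|i IHi]; first by rewrite expg1 expg0 perm1.
  by rewrite (expgSr t i.+1) permM [in X in X < _](expgSr t i) permM incr.
have le i : i <= (t ^+ i)%g p.
  by elim: i => // i IHi; have := inc i; lia.
by have := le n; have := ltn_ord ((t ^+ n)%g p); lia.
Qed.

(** The square of [t] is increasing on [F], so [t] is an involution there and swaps the points moved
    up with those moved down. Two fixed points would contradict decrease, so their number is the
    parity of [#|F|]. *)
Lemma card_fix_decreasing n (F : {set 'I_n}) (t : 'S_n) :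
  (forall p, p \in F -> t p \in F) ->
  (forall p p' : 'I_n, p \in F -> p' \in F -> p < p' -> t p' < t p) ->
  #|[set p in F | t p == p]| = odd #|F|.
Proof.
move=> F_stable decr; pose A := [set p in F | p < t p].
pose B := [set p in F | t p < p]; set D := [set p in F | t p == p].
have ttK p : p \in F -> t (t p) = p.
  move=> Fp; rewrite -permM; apply: (@increasing_perm_id _ F) => // [r|r r'] Fr.
    by rewrite permM !F_stable.
  by move=> Fr' lt_r; rewrite !permM; apply/decr/decr; rewrite ?F_stable.
have cardAB : #|A| = #|B|.
  rewrite -(card_imset _ (@perm_inj _ t)); congr #|pred_of_set _|.
  apply/setP => p; rewrite inE; apply/imsetP/andP => [[r]|[Fp lt_p]].
    by rewrite inE => /andP[Fr lt_r] ->; rewrite F_stable ?ttK.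
  by exists (t p); rewrite ?inE ttK ?F_stable.
have cardF : #|F| = #|D| + #|A| + #|B|.
  rewrite -!sum1_card (bigID (fun p => t p == p)) /= -addnA; congr (_ + _).
    by apply: eq_bigl => p; rewrite inE.
  rewrite (bigID (fun p : 'I_n => p < t p)) /=; congr (_ + _); apply: eq_bigl => p;
    rewrite inE -andbA; congr (_ && _); case: (ltngtP p (t p)) => //;
    rewrite -?val_eqE /=; lia.
have D1 : #|D| <= 1.
  apply/card_le1P => p; rewrite inE => /andP[Fp /eqP tp] p'.
  rewrite inE; apply/idP/eqP => [/andP[Fp' /eqP tp']|->]; last by rewrite Fp tp eqxx.
  have d1 := decr _ _ Fp Fp'; have d2 := decr _ _ Fp' Fp.
  by rewrite tp tp' in d1 d2; apply/val_inj => /=; lia.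
by rewrite cardF cardAB; lia.
Qed.

(** * Cycle type of the deck permutation *)

Section WordOrbits.
Variables (q K N : nat).
Local Notation X := {ffun 'I_K.+1 -> 'I_q.+1}.
Local Notation sh := (shift q K).
Implicit Types (x y : X) (C : {set X}).

(** The sum of the letters has the parity of the number of odd letters, that is, of order reversals
    in [t] steps. *)
Definition parity x (t : nat) : bool := odd (\sum_(i < t) ext x i).

Lemma parityS x t : parity x t.+1 = parity x t (+) odd (ext x t).
Proof. by rewrite /parity big_ord_recr oddD. Qed.

Lemma parityD x a b : parity x (a + b) = parity x a (+) parity ((sh ^+ a)%g x) b.
Proof.
elim: b => [|b IHb]; first by rewrite addn0 /parity big_ord0 addbF.
by rewrite addnS !parityS IHb ext_shiftX addnC addbA.
Qed.

(** The first [k + 1] letters are split in two ways: after [k] letters and after one. *)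
Lemma parity_shift x k : (sh ^+ k)%g x = x -> parity (sh x) k = parity x k.
Proof.
move=> fix_k; have := parityD x k 1; rewrite addnC parityD expg1 fix_k.
by rewrite addbC => /addIb.
Qed.

(** An orbit of the shift is a primitive necklace whose length is its cardinality. *)
Definition orbs : {set {set X}} := [set C in porbits sh | #|C| <= N].

Definition orb_rep C : X := odflt [ffun=> ord0] [pick x in C].

Lemma orb_repP C : C \in porbits sh -> orb_rep C \in C.
Proof.
case/imsetP => x _ ->; rewrite /orb_rep; case: pickP => //= /(_ x).
by rewrite porbit_id.
Qed.

Lemma porbit_rep C : C \in porbits sh -> porbit sh (orb_rep C) = C.
Proof. by move=> Cs; apply/eqP; rewrite porbit_orbits ?orb_repP. Qed.

Definition orb_odd C : bool := parity (orb_rep C) #|C|.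

Lemma card_porbit_shift x : #|porbit sh (sh x)| = #|porbit sh x|.
Proof. by have := porbit_perm sh 1 x; rewrite expg1 => ->. Qed.

(** Parity over one full period is invariant under the shift, so the chosen representative does not
    matter. *)
Lemma orb_odd_porbit x : orb_odd (porbit sh x) = parity x #|porbit sh x|.
Proof.
have Cs : porbit sh x \in porbits sh by apply: imset_f.
have inv y : parity (sh y) #|porbit sh (sh y)| = parity y #|porbit sh y|.
  by rewrite card_porbit_shift parity_shift ?permX_porbit.
by have := porbit_invariant inv (orb_repP Cs); rewrite porbit_rep.
Qed.

Lemma sum_orbs (F : X -> nat) :
  (forall x, F (sh x) = F x) -> (forall x, N < #|porbit sh x| -> F x = 0) ->
  \sum_x F x = \sum_(C in orbs) #|C| * F (orb_rep C).
Proof.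
move=> Finv F0; rewrite (bigID (fun x => #|porbit sh x| <= N)) /=.
rewrite [X in _ + X]big1 ?addn0 => [|x]; last by rewrite -ltnNge => /F0.
rewrite (big_porbits sh _ (fun C : {set X} => #|C| <= N)).
rewrite [RHS](eq_bigl (fun C => (C \in porbits sh) && (#|C| <= N))); last first.
  by move=> C; rewrite inE.
apply: eq_bigr => C /andP[Cs _]; rewrite -sum_nat_const; apply: eq_bigr => x xC.
by apply: (porbit_invariant Finv); rewrite porbit_rep.
Qed.

(* Number of [i]-cycles lying over an orbit [C] when each point of [C] has [c]
   preimages: an even orbit is covered by [c] copies of itself, an odd one by
   [c./2] double covers and possibly one copy. *)
Definition orb_cycles C (c i : nat) : nat :=
  if orb_odd C then odd c * (#|C| == i) + c./2 * (#|C|.*2 == i)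
  else c * (#|C| == i).

End WordOrbits.

Lemma card_set_sum (T : finType) (A : {set T}) (b : pred T) :
  #|[set x in A | b x]| = \sum_(x in A) b x.
Proof.
by rewrite -sum1dep_card big_mkcondr; apply: eq_bigr => x _; case: (b x).
Qed.

Section CycleType.
Variables (n m K N : nat).
Hypothesis le_nN : n <= N.
Hypothesis K_dvd : forall k, 0 < k <= N -> k %| K.+1.
Local Notation X := {ffun 'I_K.+1 -> 'I_(m.*2).+1}.
Local Notation sh := (shift (m.*2) K).
Local Notation word := {ffun 'I_n -> 'I_(m.*2.+1)}.
Local Notation orbs := (orbs (m.*2) K N).
Local Notation itin := (@itin n m K).
Local Notation itin_seq := (@itin_seq n m K).
Implicit Types (w : word) (x : X) (p : 'I_n).

Let K_dvdn k : 0 < k <= n -> k %| K.+1.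
Proof. by move=> /andP[? ?]; apply: K_dvd; lia. Qed.

Definition fiber w x : {set 'I_n} := [set p | itin w p == x].

Lemma itin_permX w p k : itin w ((deck_perm w ^+ k)%g p) = (sh ^+ k)%g (itin w p).
Proof.
elim: k => [|k IHk]; first by rewrite !expg0 !perm1.
by rewrite !expgSr !permM itin_deck_perm // IHk.
Qed.

Lemma card_fiber w x : #|fiber w x| = count_mem x (itin_seq w).
Proof. by rewrite count_map -sum1_count big_enum_cond sum1dep_card. Qed.

Lemma card_fiber_shift w x : #|fiber w (sh x)| = #|fiber w x|.
Proof.
rewrite !card_fiber; have /seq.permP <- := itin_seq_shift K_dvdn w.
by rewrite count_map; apply: eq_count => y /=; rewrite (inj_eq perm_inj).
Qed.

Lemma card_porbit_itin w p : #|porbit sh (itin w p)| %| #|porbit (deck_perm w) p|.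
Proof. by rewrite -permX_eq_id -itin_permX permX_porbit. Qed.

(** The period of an itinerary divides a cycle length, which is at most [n <= N]. *)
Lemma card_fiber0 w x : N < #|porbit sh x| -> #|fiber w x| = 0.
Proof.
move=> gtN; apply/eqP; rewrite cards_eq0; apply/eqP/setP => p; rewrite !inE.
apply/negP => /eqP eq_x; have := card_porbit_itin w p; rewrite eq_x.
move/dvdn_leq; rewrite lt0n card_porbit_neq0 => /(_ isT).
have : #|porbit (deck_perm w) p| <= n by rewrite -[X in _ <= X]card_ord max_card.
by lia.
Qed.

(** Positions with a common itinerary meet the same options, so step [k] reverses their order
    exactly when [ext x k] is odd; the reversals add up to [parity]. *)
Lemma deck_permX_mono w x k (p p' : 'I_n) :
  p \in fiber w x -> p' \in fiber w x -> p < p' ->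
  if parity x k then (deck_perm w ^+ k)%g p' < (deck_perm w ^+ k)%g p
  else (deck_perm w ^+ k)%g p < (deck_perm w ^+ k)%g p'.
Proof.
rewrite !inE => /eqP itin_p /eqP itin_p' lt_pp'.
elim: k => [|k]; first by rewrite /parity big_ord0 !expg0 !perm1.
have step (r r' : 'I_n) : itin w r = (sh ^+ k)%g x -> itin w r' = (sh ^+ k)%g x ->
    r < r' -> if odd (ext x k) then deck_perm w r' < deck_perm w r
              else deck_perm w r < deck_perm w r'.
  move=> hr hr' /(before_deck_perm w); rewrite /before -!(letter_itin K_dvdn).
  by rewrite hr hr' ltnn eqxx /= /letter ext_shiftX add0n.
have hp : itin w ((deck_perm w ^+ k)%g p) = (sh ^+ k)%g x by rewrite itin_permX itin_p.
have hp' : itin w ((deck_perm w ^+ k)%g p') = (sh ^+ k)%g x by rewrite itin_permX itin_p'.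
rewrite parityS !expgSr !permM; case: parity => /=.
  by move/(step _ _ hp' hp); case: odd.
by move/(step _ _ hp hp').
Qed.

Lemma fiber_stable w x k p :
  (sh ^+ k)%g x = x -> p \in fiber w x -> (deck_perm w ^+ k)%g p \in fiber w x.
Proof. by move=> fix_x; rewrite !inE itin_permX => /eqP ->; rewrite fix_x. Qed.

Lemma deck_permX_even w x k p : (sh ^+ k)%g x = x -> ~~ parity x k ->
  p \in fiber w x -> (deck_perm w ^+ k)%g p = p.
Proof.
move=> fix_x even_x; apply: increasing_perm_id => [r|r r' hr hr' lt_r].
  exact: fiber_stable.
by have := deck_permX_mono k hr hr' lt_r; rewrite (negbTE even_x).
Qed.

Lemma card_fiber_fix w x k : (sh ^+ k)%g x = x -> parity x k ->
  #|[set p in fiber w x | (deck_perm w ^+ k)%g p == p]| = odd #|fiber w x|.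
Proof.
move=> fix_x odd_x; apply: card_fix_decreasing => [r|r r' hr hr' lt_r].
  exact: fiber_stable.
by have := deck_permX_mono k hr hr' lt_r; rewrite odd_x.
Qed.

(** Cycle lengths over [x] are multiples of [k]. In the even case the [k]-th power is increasing on
    the fiber, hence trivial. In the odd case it is decreasing and the [2k]-th power is trivial: its
    fixed points, [odd c] in number, lie on [k]-cycles and all others on [2k]-cycles. *)
Lemma card_fiber_cycles w x (i : nat) :
  #|[set p in fiber w x | #|porbit (deck_perm w) p| == i]| =
  let k := #|porbit sh x| in let c := #|fiber w x| in
  if parity x k then odd c * (k == i) + (c./2).*2 * (k.*2 == i) else c * (k == i).
Proof.
cbv zeta; set k := #|porbit sh x|; set c := #|fiber w x|.
have fix_k : (sh ^+ k)%g x = x by rewrite permX_porbit.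
have k_gt0 : 0 < k by rewrite lt0n card_porbit_neq0.
have k_dvd p : p \in fiber w x -> k %| #|porbit (deck_perm w) p|.
  by rewrite inE => /eqP eq_x; have := card_porbit_itin w p; rewrite eq_x.
case: ifPn => par.
  have cyc p : p \in fiber w x -> #|porbit (deck_perm w) p| =
      if (deck_perm w ^+ k)%g p == p then k else k.*2.
    move=> hp; have := k_dvd p hp; rewrite permX_eq_id.
    have : #|porbit (deck_perm w) p| %| k.*2.
      rewrite -permX_eq_id; apply/eqP; apply: deck_permX_even hp.
        by rewrite -(mul2n k) permX_id_mul.
      by rewrite -(addnn k) parityD fix_k addbb.
    case/dvdnP => b eb; case/dvdnP => a ea; rewrite ea in eb *.
    have {eb} ab : a * b = 2 by nia.
    have a_le2 : a <= 2 by apply: dvdn_leq => //; rewrite -ab dvdn_mulr.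
    have [a1|a2] : a = 1 \/ a = 2 by nia.
      by rewrite a1 mul1n dvdnn.
    by rewrite a2 mul2n ifN // gtnNdvd // -(addnn k); lia.
  have cardD := card_fiber_fix w fix_k par.
  rewrite card_set_sum (eq_bigr (fun p => ((deck_perm w ^+ k)%g p == p) * (k == i)
     + ((deck_perm w ^+ k)%g p != p) * (k.*2 == i))); last first.
    by move=> p /cyc ->; case: ifP => _; rewrite ?mul1n ?mul0n ?addn0 ?add0n.
  rewrite big_split -!big_distrl -!card_set_sum cardD; congr (_ + _ * _).
  have : #|[set p in fiber w x | (deck_perm w ^+ k)%g p == p]| +
      #|[set p in fiber w x | (deck_perm w ^+ k)%g p != p]| = c.
    rewrite !card_set_sum -big_split /= -[RHS]sum1_card.
    by apply: eq_bigr => p _; case: eqP.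
  by rewrite cardD -/c -{2}(odd_double_half c) => /addnI.
rewrite card_set_sum (eq_bigr (fun=> (k == i) : nat)) ?sum_nat_const // => p hp.
congr (nat_of_bool (_ == i)); apply/eqP; rewrite eqn_dvd k_dvd // andbT.
by rewrite -permX_eq_id; apply/eqP; apply: deck_permX_even hp.
Qed.

(** After multiplication by [i], points are counted fiber by fiber; the count is constant along a
    shift orbit, which yields the factor [#|C|]. *)
Lemma ncycles_fiber w i : 0 < i ->
  ncycles (deck_perm w) i =
  \sum_(C in orbs) orb_cycles C #|fiber w (orb_rep C)| i.
Proof.
move=> i_gt0; apply/eqP; rewrite -(eqn_pmul2l i_gt0) ncyclesE; apply/eqP.
pose F x := #|[set p in fiber w x | #|porbit (deck_perm w) p| == i]|.
transitivity (\sum_x F x).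
  rewrite -sum1dep_card (partition_big (itin w) predT) //=.
  apply: eq_bigr => x _; rewrite /F -sum1dep_card; apply: eq_bigl => p.
  by rewrite inE andbC.
have Finv x : F (sh x) = F x.
  rewrite /F !card_fiber_cycles /= card_porbit_shift parity_shift ?permX_porbit //.
  by rewrite card_fiber_shift.
rewrite (sum_orbs (N := N) Finv) => [|x gtN]; last first.
  apply/eqP; rewrite -leqn0 -(card_fiber0 w gtN); apply: subset_leq_card.
  by apply/subsetP => p; rewrite inE => /andP[].
rewrite big_distrr; apply: eq_bigr => C; rewrite inE => /andP[Cs _].
rewrite /F card_fiber_cycles /= porbit_rep // /orb_cycles /orb_odd.
set k := #|C|; set c := #|fiber w _|; case: parity.
  rewrite !mulnDr; congr (_ + _).
    by case: eqP => [->|_]; rewrite ?muln0.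
  by case: eqP => [<-|_]; rewrite ?muln0 // !muln1; lia.
by case: eqP => [->|_]; rewrite ?muln0.
Qed.

(** The multiset of primitive necklaces attached to [w]. Bounding multiplicities by [N] gives a
    finite type; a fiber has at most [n <= N] points. *)
Definition mult w : {ffun {set X} -> 'I_N.+1} :=
  [ffun C => if C \in orbs then inord #|fiber w (orb_rep C)| else ord0].

Lemma multE w C : C \in orbs -> mult w C = #|fiber w (orb_rep C)| :> nat.
Proof.
move=> Co; rewrite ffunE Co inordK // ltnS (leq_trans _ le_nN) //.
by rewrite -[X in _ <= X]card_ord max_card.
Qed.

Lemma mult_ncycles w i : 0 < i ->
  ncycles (deck_perm w) i = \sum_(C in orbs) orb_cycles C (mult w C) i.
Proof.
by move=> i_gt0; rewrite ncycles_fiber //; apply: eq_bigr => C /multE ->.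
Qed.

Lemma mult_supp w C : C \notin orbs -> mult w C = ord0.
Proof. by move=> /negbTE Co; rewrite ffunE Co. Qed.

Lemma mult_weight w : \sum_(C in orbs) #|C| * mult w C = n.
Proof.
transitivity (\sum_x #|fiber w x|).
  rewrite (sum_orbs (N := N)) => [|x|x]; last exact: card_fiber0.
    by apply: eq_bigr => C /multE ->.
  exact: card_fiber_shift.
rewrite -[RHS]card_ord -[RHS]sum1_card (partition_big (itin w) predT) //=.
by apply: eq_bigr => x _; rewrite -sum1dep_card.
Qed.

Lemma porbit_orbs x : (porbit sh x \in orbs) = (#|porbit sh x| <= N).
Proof. by rewrite inE; have -> : porbit sh x \in porbits sh by apply: imset_f. Qed.

Lemma fiber_mult w x : #|fiber w x| = mult w (porbit sh x).
Proof.
case: (boolP (porbit sh x \in orbs)) => [Co|nCo]; last first.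
  by rewrite mult_supp // card_fiber0 // ltnNge -porbit_orbs.
rewrite multE //; apply/esym/(porbit_invariant (card_fiber_shift w)).
by apply: orb_repP; apply: imset_f.
Qed.

(** Fiber sizes are constant on orbits, so [mult] determines the multiset of itineraries and hence
    the word. *)
Lemma mult_inj : injective mult.
Proof.
move=> w w' eq_m; apply: (itin_seq_inj K_dvdn).
by apply/allP => x _; apply/eqP; rewrite -!card_fiber !fiber_mult eq_m.
Qed.

(** Taking each sequence as often as its orbit prescribes and sorting gives a shift-invariant sorted
    list, to which [itin_seq_surj] applies. *)
Lemma mult_surj (f : {ffun {set X} -> 'I_N.+1}) :
  (forall C, C \notin orbs -> f C = ord0) -> \sum_(C in orbs) #|C| * f C = n ->
  exists w, mult w = f.
Proof.
move=> f_supp f_sum; pose g x : nat := f (porbit sh x).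
have gsh x : g (sh x) = g x by rewrite /g; have := porbit_perm sh 1 x; rewrite expg1 => ->.
pose s := sort (@sle (m.*2) K) (flatten [seq nseq (g x) x | x <- enum X]).
have count_s y : count_mem y s = g y.
  rewrite count_sort count_flatten -map_comp sumnE big_map big_enum (bigD1 y) //=.
  rewrite count_nseq /= eqxx mul1n big1 ?addn0 // => x neq.
  by rewrite count_nseq /= (negbTE neq).
have sz_s : size s = n.
  rewrite size_sort size_flatten /shape -map_comp sumnE big_map big_enum /=.
  rewrite (eq_bigr g) => [|x _]; last by rewrite size_nseq.
  rewrite (sum_orbs (N := N) gsh) => [|x gtN]; last first.
    by rewrite /g f_supp // porbit_orbs -ltnNge.
  rewrite -[RHS]f_sum; apply: eq_bigr => C; rewrite inE => /andP[Cs _].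
  by rewrite /g porbit_rep.
have sorted_s : pairwise (@sle (m.*2) K) s.
  by rewrite -(sorted_pairwise (@sle_trans _ _)) sort_sorted //; apply: sle_total.
have perm_s : perm_eq (map sh s) s.
  apply/allP => y _; apply/eqP; rewrite count_s count_map -{2}(permKV sh y) gsh.
  by rewrite -count_s; apply: eq_count => x /=; rewrite (can2_eq (permK sh) (permKV sh)).
have [w Ew] := itin_seq_surj K_dvdn sz_s sorted_s perm_s; exists w.
apply/ffunP => C; case: (boolP (C \in orbs)) => Co; last by rewrite mult_supp ?f_supp.
apply/val_inj; rewrite /= multE // card_fiber Ew count_s /g porbit_rep //.
by case/setIdP: Co.
Qed.

End CycleType.

(** * Counting primitive necklaces *)

Local Open Scope ring_scope.

Lemma moebius_mul_prime p e : prime p -> ~~ (p %| e)%N -> (0 < e)%N ->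
  moebius (p * e) = - moebius e.
Proof.
move=> p_pr p_ndvd e_gt0; have p_gt0 := prime_gt0 p_pr.
have primes_pe : perm_eq (primes (p * e)) (p :: primes e).
  apply: uniq_perm; rewrite ?primes_uniq //= ?primes_uniq ?andbT.
    by rewrite mem_primes p_pr e_gt0 (negbTE p_ndvd).
  by move=> r; rewrite primesM // inE primes_prime // inE.
have logn_p : logn p (p * e) = 1%N.
  rewrite lognM // (logn_prime _ p_pr) eqxx.
  by rewrite lognE p_pr e_gt0 (negbTE p_ndvd).
have log_eq : {in primes e, forall r, logn r (p * e) = logn r e}.
  move=> r; rewrite mem_primes => /and3P[r_pr _ r_dvd].
  rewrite lognM // logn_prime // ; case: eqP => // rp.
  by rewrite -rp r_dvd in p_ndvd.
rewrite /moebius muln_eq0 (gtn_eqF p_gt0) (gtn_eqF e_gt0) /=.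
rewrite (perm_all _ primes_pe) (perm_size primes_pe) /= logn_p eqxx /=.
rewrite (eq_in_all (a2 := fun r => logn r e == 1%N)); last by move=> r /log_eq ->.
by case: all; rewrite ?oppr0 // exprS mulN1r.
Qed.

Lemma moebius_sqr_dvd p d : prime p -> (p ^ 2 %| d)%N -> moebius d = 0.
Proof.
move=> p_pr p2d; rewrite /moebius; case: (posnP d) => [//|d_gt0]; case: allP => // /(_ p).
have logn2 : (1 < logn p d)%N by rewrite -pfactor_dvdn.
by rewrite -logn_gt0 (ltnW logn2) => /(_ isT) /eqP; lia.
Qed.

(** For a prime [p] dividing [c], divisors divisible by [p ^ 2] contribute nothing, and the others
    cancel in pairs [e], [p * e] with [p] not dividing [e]. *)
Lemma sum_moebius c : (0 < c)%N -> \sum_(d <- divisors c) moebius d = (c == 1%N)%:R.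
Proof.
move=> c_gt0; have [->|c_neq1] := eqVneq c 1%N; first by rewrite big_seq1.
have p_pr : prime (pdiv c) by rewrite pdiv_prime //; lia.
set p := pdiv c in p_pr; have p_gt0 := prime_gt0 p_pr.
rewrite (bigID (fun d => (p %| d)%N)) /=.
rewrite (bigID (fun d => (p ^ 2 %| d)%N)) /= [X in X + _ + _]big1 => [|d /andP[_]];
  last exact: moebius_sqr_dvd.
rewrite add0r mulr0n; apply/eqP; rewrite addr_eq0 -sumrN; apply/eqP.
rewrite -big_filter -[RHS]big_filter.
rewrite (perm_big [seq (p * e)%N | e <- [seq d <- divisors c | ~~ (p %| d)%N]]) /=.
  rewrite big_map big_seq [RHS]big_seq; apply: eq_bigr => e.
  rewrite mem_filter -dvdn_divisors // => /andP[p_ndvd e_dvd].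
  by rewrite moebius_mul_prime // (dvdn_gt0 c_gt0).
apply: uniq_perm; rewrite ?filter_uniq ?divisors_uniq //.
  by rewrite map_inj_uniq ?filter_uniq ?divisors_uniq // => a b /eqP;
     rewrite eqn_pmul2l // => /eqP.
move=> d; rewrite mem_filter -dvdn_divisors //; apply/idP/mapP.
  case/andP => /andP[p_dvd p2_ndvd] d_dvd; case/dvdnP: p_dvd => e eq_d.
  exists e; last by rewrite eq_d mulnC.
  rewrite mem_filter -dvdn_divisors // (dvdn_trans _ d_dvd) ?eq_d ?dvdn_mulr // andbT.
  by apply: contra p2_ndvd => p_e; rewrite eq_d -mulnn dvdn_mul.
case=> e; rewrite mem_filter -dvdn_divisors // => /andP[p_ndvd e_dvd] ->.
rewrite dvdn_mulr // -mulnn dvdn_pmul2l // p_ndvd /=.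
by rewrite Gauss_dvd ?pdiv_dvd // prime_coprime.
Qed.

Lemma sum_divisors_mul (R : nmodType) (F : nat -> R) k d :
  (0 < k)%N -> (d %| k)%N -> odd d ->
  \sum_(e <- divisors (k %/ d) | odd e) F (d * e)%N =
  \sum_(c <- divisors k | (d %| c)%N && odd c) F c.
Proof.
move=> k_gt0 d_dvd d_odd; have d_gt0 := dvdn_gt0 k_gt0 d_dvd.
have kd_gt0 : (0 < k %/ d)%N by rewrite divn_gt0 // dvdn_leq.
rewrite -[RHS]big_filter_cond.
rewrite [RHS](perm_big [seq (d * e)%N | e <- divisors (k %/ d)]) /=.
  by rewrite big_map; apply: eq_bigl => e; rewrite oddM d_odd.
rewrite perm_sym; apply: uniq_perm; rewrite ?filter_uniq ?divisors_uniq //.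
  by rewrite map_inj_uniq ?divisors_uniq // => a b /eqP;
     rewrite eqn_pmul2l // => /eqP.
move=> c; rewrite mem_filter -dvdn_divisors //; apply/mapP/andP.
  case=> e; rewrite -dvdn_divisors // => e_dvd ->; split; first exact: dvdn_mulr.
  by rewrite -(divnK d_dvd) mulnC dvdn_mul.
case=> /dvdnP[e ->] ed_dvd; exists e; last by rewrite mulnC.
by rewrite -dvdn_divisors // dvdn_divRL.
Qed.

(** With [c = d * e] the sums are exchanged; all divisors of an odd [c] are odd, so the inner sum is
    the full Moebius sum. *)
Lemma odd_moebius_inversion (F : nat -> rat) k : (0 < k)%N ->
  \sum_(d <- divisors k | odd d) (moebius d)%:~R *
     \sum_(e <- divisors (k %/ d) | odd e) F (k %/ d %/ e)%N = F k.
Proof.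
move=> k_gt0.
rewrite big_seq_cond (eq_bigr (fun d => \sum_(c <- divisors k | (d %| c)%N && odd c)
    (moebius d)%:~R * F (k %/ c)%N)); last first.
  move=> d /andP[]; rewrite -dvdn_divisors // => d_dvd d_odd.
  rewrite -big_distrr -(sum_divisors_mul (fun c => F (k %/ c)%N)) //=.
  by congr (_ * _); apply: eq_bigr => e _; rewrite divnMA.
rewrite -big_seq_cond (exchange_big_dep (fun c => odd c)) /=; last by move=> d c _ /andP[].
rewrite big_seq_cond (eq_bigr (fun c => (c == 1%N)%:R * F (k %/ c)%N)); last first.
  move=> c /andP[]; rewrite -dvdn_divisors // => c_dvd c_odd.
  have c_gt0 := dvdn_gt0 k_gt0 c_dvd.
  rewrite -big_distrl -(rmorph_sum (intr : int -> rat)) /=; congr (_ * _).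
  rewrite -[RHS](rmorph_nat (intr : int -> rat)) -sum_moebius //; congr (_%:~R).
  rewrite -big_filter; apply: perm_big; apply: uniq_perm;
    rewrite ?filter_uniq ?divisors_uniq // => d.
  rewrite mem_filter -!dvdn_divisors // c_odd andbT.
  apply/idP/idP => [/andP[/andP[_ ->]]//|d_dvd].
  by rewrite d_dvd (dvdn_trans d_dvd c_dvd) (dvdn_odd d_dvd).
rewrite -big_seq_cond big_mkcond (bigD1_seq 1%N) ?divisors_uniq ?divisor1 //=.
rewrite mul1r divn1 big1 ?addr0 // => c /negbTE ->.
by rewrite mul0r; case: odd.
Qed.

Lemma sum_divisors_div (R : nmodType) (F : nat -> R) k : (0 < k)%N ->
  \sum_(d <- divisors k) F d = \sum_(d <- divisors k) F (k %/ d)%N.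
Proof.
move=> k_gt0; rewrite -(big_map (fun d => k %/ d)%N predT F); apply: perm_big.
have divK d : (d %| k)%N -> (k %/ (k %/ d) = d)%N.
  move=> d_dvd; have d_gt0 := dvdn_gt0 k_gt0 d_dvd.
  by rewrite -{1}(divnK d_dvd) mulKn // divn_gt0 // dvdn_leq.
apply: uniq_perm; first exact: divisors_uniq.
  rewrite map_inj_in_uniq ?divisors_uniq // => a b.
  by rewrite -!dvdn_divisors // => ha hb eq_ab; rewrite -(divK a) // eq_ab divK.
move=> d; rewrite -dvdn_divisors //; apply/idP/mapP => [d_dvd|[e]].
  by exists (k %/ d)%N; rewrite ?divK // -dvdn_divisors // dvdn_div.
by rewrite -dvdn_divisors // => e_dvd ->; apply: dvdn_div.
Qed.

Lemma sum_divisors_half (R : nmodType) (F : nat -> R) k : (0 < k)%N ->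
  \sum_(d <- divisors k | ~~ odd d) F d./2 =
  \sum_(d <- divisors k | ~~ odd (k %/ d)) F d.
Proof.
move=> k_gt0; rewrite -big_filter -[RHS]big_filter.
rewrite (perm_big [seq d.*2 | d <- [seq d <- divisors k | ~~ odd (k %/ d)]]) /=.
  by rewrite big_map; apply: eq_bigr => d _; rewrite doubleK.
apply: uniq_perm; rewrite ?filter_uniq ?divisors_uniq //.
  by rewrite map_inj_uniq ?filter_uniq ?divisors_uniq //; apply: double_inj.
move=> d; rewrite mem_filter -dvdn_divisors //; apply/andP/mapP => [[d_even d_dvd]|[e]].
  have eq_d : d = d./2.*2 by rewrite -[LHS]odd_double_half (negbTE d_even).
  exists d./2 => //; rewrite mem_filter -dvdn_divisors //.
  case/dvdnP: d_dvd => b eq_k.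
  have eq_k' : k = (b * 2 * d./2)%N by rewrite eq_k {1}eq_d -muln2 mulnA mulnAC.
  have d2_gt0 : (0 < d./2)%N by rewrite eq_k' muln_gt0 in k_gt0; case/andP: k_gt0.
  by rewrite eq_k' mulnK // dvdn_mull // oddM andbF.
rewrite mem_filter -dvdn_divisors // => /andP[ke_even e_dvd] ->.
rewrite odd_double; split=> //; rewrite -(divnK e_dvd) -mul2n dvdn_mul //.
by rewrite dvdn2.
Qed.

Section Counting.
Variables (m K : nat).
Local Notation q := m.*2.
Local Notation X := {ffun 'I_K.+1 -> 'I_q.+1}.
Local Notation sh := (shift q K).
Implicit Types (x : X) (C : {set X}).

(** A word fixed by [sh ^+ k] is the repetition of an arbitrary word of length [k], and the sum over
    these factors letter by letter. *)
Lemma sum_fix_words (G : 'I_q.+1 -> rat) k : (0 < k)%N -> (k %| K.+1)%N ->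
  \sum_(x : X | (sh ^+ k)%g x == x) \prod_(i < k) G (ext x i) = (\sum_a G a) ^+ k.
Proof.
case: k => // k _ k_dvd; rewrite -[k.+1 in RHS]card_ord -prodr_const bigA_distr_bigA /=.
pose h (y : {ffun 'I_k.+1 -> 'I_q.+1}) : X := [ffun t : 'I_K.+1 => y (inord (t %% k.+1))].
pose h' x : {ffun 'I_k.+1 -> 'I_q.+1} := [ffun i : 'I_k.+1 => ext x i].
have ext_h y t : ext (h y) t = y (inord (t %% k.+1)).
  rewrite /h (ext_ffun (f := fun t => y (inord (t %% k.+1)))) // => s.
  by rewrite -modnDmr (eqP k_dvd) addn0.
have hK y : h' (h y) = y.
  by apply/ffunP => i; rewrite ffunE ext_h modn_small // inord_val.
rewrite (reindex_onto h h') => [|x /eqP fix_x]; last first.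
  apply: extP => t; rewrite ext_h ffunE inordK ?ltn_pmod // [in RHS](divn_eq t k.+1).
  rewrite addnC -ext_shiftX; congr (ext _ _); apply/esym.
  exact: permX_id_mul.
apply: eq_big => [y|y _]; last first.
  by apply: eq_bigr => i _; rewrite ext_h modn_small // inord_val.
rewrite hK eqxx andbT; apply/eqP; apply: extP => t.
by rewrite ext_shiftX !ext_h modnDr.
Qed.

Lemma card_fix_words k : (0 < k)%N -> (k %| K.+1)%N ->
  \sum_(x : X | (sh ^+ k)%g x == x) 1 = (q.+1 ^ k)%:R :> rat.
Proof.
move=> k_gt0 k_dvd; have := sum_fix_words (fun=> 1) k_gt0 k_dvd.
have -> : \sum_(a < q.+1) 1 = q.+1%:R :> rat by rewrite sumr_const card_ord.
by rewrite natrX => <-; apply: eq_bigr => x _; rewrite big1_eq.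
Qed.

(** There is one more even letter than odd ones, so each of the [k] places contributes a total sign
    [1]. *)
Lemma sum_sign_fix_words k : (0 < k)%N -> (k %| K.+1)%N ->
  \sum_(x : X | (sh ^+ k)%g x == x) (-1) ^+ parity x k = 1 :> rat.
Proof.
move=> k_gt0 k_dvd; have := sum_fix_words (fun a => (-1) ^+ (a : nat)) k_gt0 k_dvd.
have -> : \sum_(a < q.+1) (-1) ^+ (a : nat) = 1 :> rat.
  elim: m => [|j IHj]; first by rewrite big_ord1.
  by rewrite doubleS 2!big_ord_recr /= IHj (exprS _ j.*2.+1) mulN1r addrK.
rewrite expr1n => eq1; rewrite -[RHS]eq1; apply: eq_bigr => x _.
rewrite /parity signr_odd; elim: k {k_gt0 k_dvd eq1} => [|k IHk].
  by rewrite !big_ord0.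
by rewrite !big_ord_recr /= exprD IHk.
Qed.

Lemma sum_fix_divisors (F : X -> rat) k : (0 < k)%N ->
  \sum_(x : X | (sh ^+ k)%g x == x) F x =
  \sum_(d <- divisors k) \sum_(x : X | #|porbit sh x| == d) F x.
Proof.
move=> k_gt0; rewrite big_seq.
rewrite (exchange_big_dep (fun x => (sh ^+ k)%g x == x)) /=; last first.
  by move=> d x; rewrite -dvdn_divisors // permX_eq_id => d_dvd /eqP ->.
apply: eq_bigr => x; rewrite permX_eq_id => x_dvd.
rewrite -big_seq_cond (eq_bigl (pred1 #|porbit sh x|)); last first.
  by move=> d; rewrite /= eq_sym.
rewrite big_mkcond (bigD1_seq #|porbit sh x|) ?divisors_uniq -?dvdn_divisors //=.
by rewrite eqxx big1 ?addr0 // => d /negbTE ->.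
Qed.

Lemma parityX x b k : (sh ^+ k)%g x = x -> parity x (b * k) = odd b && parity x k.
Proof.
move=> fix_k; elim: b => [|b IHb]; first by rewrite mul0n /parity big_ord0.
by rewrite mulSn parityD fix_k IHb /=; case: odd; case: parity.
Qed.

(* The numbers of primitive necklaces of length [k] with an odd, resp. even,
   number of odd letters. *)
Definition num_odd k := #|[set C in porbits sh | (#|C| == k) && orb_odd C]|.
Definition num_even k := #|[set C in porbits sh | (#|C| == k) && ~~ orb_odd C]|.

Lemma num_oddE k : (num_odd k * k)%:R =
  \sum_(x : X | #|porbit sh x| == k) (parity x k)%:R :> rat.
Proof.
rewrite /num_odd -sum_nat_cond_const -natr_sum; congr (_%:R).
rewrite (eq_bigr (fun C : {set X} => \sum_(x in C) 1)%N); last first.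
  by move=> C /and3P[_ /eqP <- _]; rewrite sum1_card.
rewrite -(big_porbits sh _ (fun C => (#|C| == k) && orb_odd C)) /= big_mkcondr.
by apply: eq_bigr => x /eqP <-; rewrite orb_odd_porbit; case: parity.
Qed.

Lemma num_evenE k : (num_even k * k)%:R =
  \sum_(x : X | #|porbit sh x| == k) (~~ parity x k)%:R :> rat.
Proof.
rewrite /num_even -sum_nat_cond_const -natr_sum; congr (_%:R).
rewrite (eq_bigr (fun C : {set X} => \sum_(x in C) 1)%N); last first.
  by move=> C /and3P[_ /eqP <- _]; rewrite sum1_card.
rewrite -(big_porbits sh _ (fun C => (#|C| == k) && ~~ orb_odd C)) /= big_mkcondr.
by apply: eq_bigr => x /eqP <-; rewrite orb_odd_porbit; case: parity.
Qed.

(** The plain count minus the signed count is twice the number of odd words. A word of primitive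
    period [k %/ d] is read [d] times, so it is odd iff [d] and its primitive part are. *)
Lemma sum_num_odd k : (0 < k)%N -> (k %| K.+1)%N ->
  (q.+1 ^ k)%:R - 1 =
  2 * \sum_(d <- divisors k | odd d) (num_odd (k %/ d)%N * (k %/ d)%N)%:R :> rat.
Proof.
move=> k_gt0 k_dvd; rewrite -card_fix_words //.
rewrite -[X in _ - X](sum_sign_fix_words k_gt0 k_dvd).
rewrite -sumrB (eq_bigr (fun x => 2 * (parity x k)%:R)) => [|x _]; last first.
  by case: parity; rewrite ?mulr0 ?mulr1 ?expr0 ?subrr // expr1 opprK.
rewrite -big_distrr sum_fix_divisors //= sum_divisors_div // [in RHS]big_mkcond /=.
congr (_ * _); rewrite big_seq [RHS]big_seq; apply: eq_bigr => d.
rewrite -dvdn_divisors // => d_dvd; rewrite num_oddE.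
have d_gt0 := dvdn_gt0 k_gt0 d_dvd.
have par x : #|porbit sh x| = (k %/ d)%N ->
    parity x k = odd d && parity x (k %/ d)%N.
  by move=> eq_x; rewrite -{1}(divnK d_dvd) mulnC parityX // -eq_x permX_porbit.
case: ifP => d_odd; last rewrite big1 //; last by move=> x /eqP /par ->; rewrite d_odd.
by apply: eq_bigr => x /eqP /par ->; rewrite d_odd.
Qed.

(** Inverting [sum_num_odd] over odd divisors counts odd primitive words twice; the prefactor of
    [fim] removes the [2] and passes from words to necklaces. *)
Lemma num_oddP k : (0 < k)%N -> (k %| K.+1)%N -> fim k m = (num_odd k)%:R.
Proof.
move=> k_gt0 k_dvd; rewrite /fim big_seq_cond.
rewrite (eq_bigr (fun d => 2 * ((moebius d)%:~R *
   \sum_(e <- divisors (k %/ d)%N | odd e)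
      (num_odd (k %/ d %/ e)%N * (k %/ d %/ e)%N)%:R))); last first.
  move=> d /andP[]; rewrite -dvdn_divisors // => d_dvd _.
  rewrite sum_num_odd; first by rewrite mulrCA.
    have d_gt0 := dvdn_gt0 k_gt0 d_dvd.
    by rewrite divn_gt0 // (dvdn_leq k_gt0 d_dvd).
  exact: dvdn_trans (dvdn_div d_dvd) k_dvd.
rewrite -big_seq_cond -big_distrr /=.
rewrite (odd_moebius_inversion (fun j => (num_odd j * j)%:R)) //.
rewrite -natrM (_ : 2 * _ = k.*2 * num_odd k)%N; last by rewrite -muln2; lia.
by rewrite natrM mulKf // pnatr_eq0; lia.
Qed.

(* The defect [t k * k] of the identity sums to [1] over the divisors of every
   [k], because the signed count of the words of length [k] is [1]. *)
Lemma num_evenP k : (0 < k)%N -> (k %| K.+1)%N ->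
  (num_even k + (if odd k then 0 else num_odd k./2) = num_odd k + (k == 1))%N.
Proof.
pose t k : rat := (num_even k + (if odd k then 0 else num_odd k./2))%:R - (num_odd k)%:R.
have sum_t j : (0 < j)%N -> (j %| K.+1)%N -> \sum_(d <- divisors j) t d * d%:R = 1.
  move=> j_gt0 j_dvd; rewrite -[RHS](sum_sign_fix_words j_gt0 j_dvd).
  rewrite sum_fix_divisors //.
  pose O d : rat := (num_odd d * d)%:R.
  rewrite (eq_bigr (fun d => (num_even d * d)%:R - O d +
     if ~~ odd d then 2 * O d./2 else 0)); last first.
    move=> d _; rewrite /t /O !natrM natrD !mulrBl mulrDl addrAC; congr (_ + _).
    case: ifPn => d_odd /=; first by rewrite mul0r.
    rewrite mulrCA -[X in _ = _ * X]natrM mul2n; congr (_ * _%:R).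
    by rewrite -[LHS]odd_double_half (negbTE d_odd).
  (* Reindexed by halves, the doubled terms sit at the [d] with [j %/ d] even. There an odd word of
     period [d] gets [-1 + 2 = 1], which is its sign when read to length [j]. *)
  rewrite big_split -big_mkcond (sum_divisors_half (fun d => 2 * O d)) //=.
  rewrite [X in _ + X]big_mkcond -big_split /=.
  rewrite big_seq [RHS]big_seq; apply: eq_bigr => d; rewrite -dvdn_divisors // => d_dvd.
  have par x : #|porbit sh x| = d -> parity x j = odd (j %/ d) && parity x d.
    by move=> eq_x; rewrite -{1}(divnK d_dvd) parityX // -eq_x permX_porbit.
  rewrite /O num_oddE num_evenE -sumrB.
  case: ifPn => jd.
    rewrite big_distrr -big_split /=; apply: eq_bigr => x /eqP /par ->.
    by rewrite (negbTE jd); case: parity.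
  rewrite addr0; apply: eq_bigr => x /eqP /par ->; rewrite (negbNE jd).
  by case: parity.
suff tE : forall k, (0 < k)%N -> (k %| K.+1)%N -> t k * k%:R = (k == 1%N)%:R.
  move=> k_gt0 k_dvd; have := tE k k_gt0 k_dvd.
  have [->|k_neq1] := eqVneq k 1%N.
    rewrite mulr1 /t => /eqP; rewrite subr_eq nat1r eqr_nat => /eqP ->.
    by rewrite addn1.
  move/eqP; rewrite mulf_eq0 pnatr_eq0 (gtn_eqF k_gt0) orbF subr_eq0 eqr_nat addn0.
  by move/eqP.
(* The proper divisors contribute [1] through [d = 1] alone, so nothing is left for [k] unless
   [k = 1]. *)
elim/ltn_ind => {}k IHk k_gt0 k_dvd; have := sum_t k k_gt0 k_dvd.
rewrite (bigD1_seq k) ?divisors_uniq ?divisors_id //=.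
rewrite big_seq_cond (eq_bigr (fun d => (d == 1%N)%:R)) => [|d /andP[]]; last first.
  rewrite -dvdn_divisors // => d_dvd d_neq; apply: IHk.
  - by have := dvdn_leq k_gt0 d_dvd; lia.
  - exact: dvdn_gt0 d_dvd.
  - exact: dvdn_trans d_dvd k_dvd.
rewrite -big_seq_cond; have [->|k_neq1] := eqVneq k 1%N.
  by rewrite (_ : divisors 1 = [:: 1%N]) // big_cons big_nil /= addr0.
rewrite big_mkcond (bigD1_seq 1%N) ?divisors_uniq ?divisor1 //= eq_sym k_neq1.
rewrite big1 => [|d /negbTE ->]; last by case: ifP.
by rewrite addr0 => /eqP; rewrite -subr_eq0 addrK => /eqP.
Qed.

End Counting.

(** * Truncated power series *)

Section Truncation.
Variables (R : comNzRingType) (N : nat).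
Implicit Types a b : {poly R}.

(** Congruence modulo ['X^N.+1]. *)
Definition eq_trunc a b := forall i, (i <= N)%N -> a`_i = b`_i.

Lemma eq_trunc_trans b a c : eq_trunc a b -> eq_trunc b c -> eq_trunc a c.
Proof. by move=> ab bc i le_i; rewrite ab ?bc. Qed.

Lemma eq_trunc_refl a : eq_trunc a a.
Proof. by []. Qed.

Lemma eq_trunc_sym a b : eq_trunc a b -> eq_trunc b a.
Proof. by move=> ab i le_i; rewrite ab. Qed.

Lemma eq_truncD a b a' b' :
  eq_trunc a a' -> eq_trunc b b' -> eq_trunc (a + b) (a' + b').
Proof. by move=> aa bb i le_i; rewrite !coefD aa ?bb. Qed.

Lemma eq_truncM a b a' b' :
  eq_trunc a a' -> eq_trunc b b' -> eq_trunc (a * b) (a' * b').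
Proof.
move=> aa bb i le_i; rewrite !coefM; apply: eq_bigr => j _.
by have := ltn_ord j => lt_j; rewrite aa ?bb //; lia.
Qed.

Lemma eq_trunc_mul0 a b : eq_trunc b 0 -> eq_trunc (a * b) 0.
Proof. by move=> b0; rewrite -(mulr0 a); apply: eq_truncM. Qed.

Lemma eq_trunc_prod (I : Type) (r : seq I) (P : pred I) (F G : I -> {poly R}) :
  (forall i, P i -> eq_trunc (F i) (G i)) ->
  eq_trunc (\prod_(i <- r | P i) F i) (\prod_(i <- r | P i) G i).
Proof. by move=> FG; elim/big_ind2: _ => // *; apply: eq_truncM. Qed.

Lemma eq_trunc_take a b : eq_trunc a b -> take_poly N.+1 a = take_poly N.+1 b.
Proof.
by move=> ab; apply/polyP => i; rewrite !coef_take_poly ltnS; case: leqP => // /ab.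
Qed.

Definition mono (z : R) k : {poly R} := z%:P * 'X^k.

Lemma coef_mono z k i : (mono z k)`_i = if k == i then z else 0.
Proof. by rewrite coefCM coefXn eq_sym; case: eqP; rewrite ?mulr1 ?mulr0. Qed.

Lemma monoM z z' k k' : mono z k * mono z' k' = mono (z * z') (k + k').
Proof. by rewrite /mono polyCM exprD mulrACA. Qed.

Lemma monoX z k n : mono z k ^+ n = mono (z ^+ n) (k * n).
Proof. by rewrite /mono exprMn -polyC_exp exprM. Qed.

Lemma mono1 : mono 1 0 = 1.
Proof. by rewrite /mono expr0 mulr1. Qed.

Lemma mono_prod (I : Type) (r : seq I) (P : pred I) (z : I -> R) k :
  \prod_(i <- r | P i) mono (z i) (k i) =
  mono (\prod_(i <- r | P i) z i) (\sum_(i <- r | P i) k i).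
Proof.
elim/big_rec3: _ => [|i y1 y2 y3 _ ->]; first by rewrite mono1.
by rewrite monoM.
Qed.

Lemma mono_eq0 z k : (N < k)%N -> eq_trunc (mono z k) 0.
Proof. by move=> gtN i le_i; rewrite coef_mono coef0; case: eqP => //; lia. Qed.

Definition geom (a : {poly R}) : {poly R} := \sum_(j < N.+1) a ^+ j.

Lemma geomP a : eq_trunc (a ^+ N.+1) 0 -> eq_trunc ((1 - a) * geom a) 1.
Proof.
move=> a0 i le_i; have := subrX1 a N.+1; rewrite -/(geom a) => eq_g.
have -> : (1 - a) * geom a = 1 - a ^+ N.+1 by rewrite -opprB mulNr -eq_g opprB.
by rewrite coefB a0 // coef0 subr0.
Qed.

Lemma geom0 : geom 0 = 1.
Proof.
rewrite /geom big_ord_recl expr0 big1 ?addr0 // => i _.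
by rewrite expr0n.
Qed.

(** With [x = a_k] and [y = a_2k] the summands are the weights of an odd necklace of multiplicity
    [j]; indices [2l] and [2l + 1] are paired. *)
Lemma sum_pairs (x y : {poly R}) L :
  \sum_(0 <= j < L.*2) x ^+ odd j * y ^+ j./2 = (1 + x) * \sum_(j < L) y ^+ j.
Proof.
elim: L => [|L IHL]; first by rewrite big_geq ?big_ord0 ?mulr0.
rewrite doubleS 2?big_nat_recr //= IHL big_ord_recr /= mulrDr.
rewrite -addrA; congr (_ + _).
by rewrite odd_double doubleK uphalf_double expr0 expr1 mulrDl !mul1r.
Qed.

End Truncation.

Lemma prod_double (R : comNzRingType) (H : nat -> R) L :
  \prod_(1 <= k < L.+1) H k.*2 = \prod_(1 <= k < L.*2.+1 | ~~ odd k) H k.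
Proof.
elim: L => [|L IHL]; first by rewrite !big_geq.
rewrite big_nat_recr //= IHL doubleS big_mkcond [in RHS]big_mkcond /=.
by rewrite [in RHS]big_nat_recr // [in RHS]big_nat_recr //= odd_double /= mulr1.
Qed.

Lemma gbinom_pascal (s : rat) k :
  gbinom (s + 1) k.+1 = gbinom s k.+1 + gbinom s k.
Proof.
rewrite /gbinom big_ord_recl [in RHS]big_ord_recr /= subr0.
rewrite (eq_bigr (fun j : 'I_k => s - j%:R)) => [|j _]; last first.
  by rewrite /bump add1n -natr1; ring.
set P := \prod_(_ < _) _; rewrite factS natrM.
have k1 : k.+1%:R != 0 :> rat by rewrite pnatr_eq0.
have kf : k`!%:R != 0 :> rat by rewrite pnatr_eq0 -lt0n fact_gt0.
by move: k1 kf; rewrite -natr1 => k1 kf; field; rewrite k1 kf.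
Qed.

(** Pascal's rule is multiplication by [1 + b]; cutting the series leaves one top term, which
    vanishes modulo the truncation when [b] is nilpotent there. *)
Lemma sum_pascal (R : comNzRingType) (g h : nat -> R) (b : R) n :
  g 0%N = h 0%N -> (forall j, h j.+1 = g j.+1 + g j) ->
  (\sum_(j < n.+1) g j * b ^+ j) * (1 + b) =
  \sum_(j < n.+1) h j * b ^+ j + g n * b ^+ n.+1.
Proof.
move=> gh0 ghS; elim: n => [|n IHn].
  by rewrite !big_ord1 gh0 expr0 mulr1 mulrDr mulr1 expr1.
rewrite big_ord_recr /= mulrDl IHn [in RHS]big_ord_recr /= ghS [b ^+ n.+2]exprSr.
ring.
Qed.

Section BinomialSeries.
Variable N : nat.
Local Notation R := {mpoly rat[N]}.
Implicit Types a b : {poly R}.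

Definition binom_series (s : rat) b : {poly R} :=
  \sum_(j < N.+1) cst N (gbinom s j) * b ^+ j.

Lemma gbinom0 s : gbinom s 0 = 1.
Proof. by rewrite /gbinom big_ord0 fact0 mul1r invr1. Qed.

Lemma binom_series0 b : binom_series 0 b = 1.
Proof.
rewrite /binom_series big_ord_recl expr0 mulr1 gbinom0 big1 => [|i _].
  by rewrite addr0 /cst mpolyC1.
have -> : gbinom 0 (lift ord0 i) = 0.
  by rewrite /gbinom lift0 big_ord_recl subrr !mul0r.
by rewrite /cst mpolyC0 mul0r.
Qed.

Lemma binom_seriesS s b : eq_trunc N (b ^+ N.+1) 0 ->
  eq_trunc N (binom_series (s + 1) b) (binom_series s b * (1 + b)).
Proof.
move=> b0.
have cstD x y : cst N (x + y) = cst N x + cst N y by rewrite /cst mpolyCD polyCD.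
rewrite /binom_series (sum_pascal (g := fun j => cst N (gbinom s j))
  (h := fun j => cst N (gbinom (s + 1) j))); last first.
- by move=> j; rewrite gbinom_pascal cstD.
- by rewrite !gbinom0.
rewrite -[X in eq_trunc _ X _]addr0; apply: eq_truncD; first exact: eq_trunc_refl.
exact/eq_trunc_sym/eq_trunc_mul0.
Qed.

Lemma binom_series_nat n b : eq_trunc N (b ^+ N.+1) 0 ->
  eq_trunc N (binom_series n%:R b) ((1 + b) ^+ n).
Proof.
move=> b0; elim: n => [|n IHn].
  rewrite (mulr0n 1) binom_series0 expr0; exact: eq_trunc_refl.
rewrite -natr1 exprSr; apply: eq_trunc_trans (binom_seriesS _ b0) _.
exact: eq_truncM IHn (@eq_trunc_refl _ _ _).
Qed.

(** Raising the exponent from [- n.+1] to [- n] multiplies by [1 - a], so lowering it multiplies by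
    the inverse [geom N a]. *)
Lemma binom_series_negnat n a : eq_trunc N (a ^+ N.+1) 0 ->
  eq_trunc N (binom_series (- n%:R) (- a)) (geom N a ^+ n).
Proof.
move=> a0; have na0 : eq_trunc N ((- a) ^+ N.+1) 0.
  by rewrite exprNn; apply: eq_trunc_mul0.
elim: n => [|n IHn].
  rewrite (mulr0n 1) oppr0 binom_series0 expr0; exact: eq_trunc_refl.
have nS : - n%:R = - n.+1%:R + 1 :> rat by rewrite -natr1 opprD addrNK.
have := binom_seriesS (- n.+1%:R) na0; rewrite -nS => stepS.
rewrite exprSr; apply: eq_trunc_trans (eq_truncM IHn (@eq_trunc_refl _ _ (geom N a))).
apply: eq_trunc_sym; apply: eq_trunc_trans (eq_truncM stepS (@eq_trunc_refl _ _ _)) _.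
rewrite -mulrA -[X in eq_trunc _ _ X]mulr1.
exact: eq_truncM (@eq_trunc_refl _ _ _) (geomP a0).
Qed.

(** This natural exponent suffices for the theorem because [fim] counts necklaces. *)
Lemma ratpow_trP n a : eq_trunc N (a ^+ N.+1) 0 ->
  eq_trunc N (ratpow_tr n%:R a) ((1 + a) ^+ n * geom N a ^+ n).
Proof.
by move=> a0; apply: eq_truncM; [apply: binom_series_nat|apply: binom_series_negnat].
Qed.

End BinomialSeries.

(** * The cycle index of the shuffle *)

Section CycleSeries.
Variables (N m : nat).
Local Notation R := {mpoly rat[N]}.
Local Notation q := m.*2.+1.
(* Every length up to [N] divides the common period [K.+1]. *)
Local Notation K := N`!.-1.
Local Notation X := {ffun 'I_K.+1 -> 'I_(m.*2).+1}.
Local Notation sh := (shift (m.*2) K).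
Local Notation orbs := (orbs (m.*2) K N).
Implicit Types (C : {set X}).

Let K_dvd k : (0 < k <= N)%N -> (k %| K.+1)%N.
Proof. by move=> hk; rewrite prednK ?fact_gt0 // dvdn_fact. Qed.

(* [z_k]; it is [0] when [k] is not in the range [1..N]. *)
Definition zvar (k : nat) : R := \sum_(j < N | j.+1 == k) 'X_j.

Lemma zvarS (j : 'I_N) : zvar j.+1 = 'X_j.
Proof. by apply: big_pred1 => i; rewrite eqSS. Qed.

Lemma zvar0 k : (N < k)%N -> zvar k = 0.
Proof. by move=> gtN; apply: big_pred0 => j; have := ltn_ord j; lia. Qed.

Definition avar k : {poly R} := mono ((q%:R : rat) ^- k *: zvar k) k.

Lemma atermE (j : 'I_N) : aterm m j = avar j.+1.
Proof. by rewrite /aterm /avar zvarS. Qed.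

Lemma avar_nil k : (0 < k)%N -> eq_trunc N (avar k ^+ N.+1) 0.
Proof. by move=> k_gt0; rewrite monoX; apply: mono_eq0; nia. Qed.

Lemma geom_avar k : (N < k)%N -> geom N (avar k) = 1.
Proof. by move=> gtN; rewrite /avar zvar0 // scaler0 /mono mul0r geom0. Qed.

(** The product of the [a_i] over the cycles lying above [C] at multiplicity [j], as listed by
    [orb_cycles]. *)
Definition orb_weight C j : {poly R} :=
  if orb_odd C then avar #|C| ^+ odd j * avar #|C|.*2 ^+ j./2 else avar #|C| ^+ j.

Definition orb_zweight C j : R :=
  if orb_odd C then zvar #|C| ^+ odd j * zvar #|C|.*2 ^+ j./2 else zvar #|C| ^+ j.

Lemma orb_weightE C j :
  orb_weight C j = mono ((q%:R : rat) ^- (#|C| * j) *: orb_zweight C j) (#|C| * j).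
Proof.
have eq_j k : (k * odd j + k.*2 * j./2 = k * j)%N.
  by have := odd_double_half j; nia.
rewrite /orb_weight /orb_zweight; case: orb_odd; rewrite !monoX ?monoM !exprZn.
  rewrite eq_j; congr mono; rewrite -scalerAl -scalerAr scalerA; congr (_ *: _).
  by rewrite -!exprVn -!exprM -exprD eq_j.
by congr mono; rewrite -!exprVn -exprM.
Qed.

Lemma orbs_gt0 C : C \in orbs -> (0 < #|C|)%N.
Proof.
by rewrite inE => /andP[/imsetP[x _ ->] _]; rewrite lt0n card_porbit_neq0.
Qed.

Definition orb_factor C : {poly R} :=
  if orb_odd C then (1 + avar #|C|) * geom N (avar #|C|.*2)
  else geom N (avar #|C|).

Lemma orb_factorP C : C \in orbs ->
  eq_trunc N (orb_factor C) (\sum_(j < N.+1) orb_weight C j).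
Proof.
move=> Co; have C_gt0 := orbs_gt0 Co.
rewrite /orb_factor; case odd_C: (orb_odd C); last first.
  by rewrite /orb_weight odd_C.
(* [sum_pairs] yields twice as many terms; those with [j > N] have degree [#|C| * j > N]. *)
rewrite -sum_pairs (big_cat_nat (n := N.+1)) //=; last by lia.
rewrite -[X in eq_trunc _ _ X]addr0; apply: eq_truncD.
  by rewrite big_mkord /orb_weight odd_C.
move=> i le_i; rewrite coef_sum coef0 big_nat big1 // => j /andP[gtN _].
have := orb_weightE C j; rewrite /orb_weight odd_C => ->.
by rewrite (mono_eq0 (N := N)) ?coef0 //; nia.
Qed.

Definition weight (f : {ffun {set X} -> 'I_N.+1}) : nat :=
  \sum_(C in orbs) #|C| * f C.

(** Expanding the product of sums amounts to choosing a multiplicity for every necklace; the power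
    of [u] is the total length. *)
Lemma coef_prod_orbs n : (n <= N)%N ->
  (\prod_(C in orbs) orb_factor C)`_n =
  \sum_(f in pffun_on ord0 (mem orbs) predT | weight f == n)
     (q%:R : rat) ^- n *: \prod_(C in orbs) orb_zweight C (f C).
Proof.
move=> le_n; rewrite (eq_trunc_prod _ orb_factorP) //.
rewrite (big_distr_big ord0) coef_sum /= big_mkcondr /=; apply: eq_bigr => f _.
rewrite (eq_bigr _ (fun C _ => orb_weightE C (f C))) mono_prod coef_mono -/(weight f).
case: eqP => // wf; rewrite scaler_prod; congr (_ *: _).
by rewrite -wf -exprVn /weight expr_sum; apply: eq_bigr => C _; rewrite exprVn.
Qed.

Lemma prod_zvar k e : (0 < k)%N -> (k <= N)%N || (e == 0%N) ->
  \prod_(j < N) 'X_j ^+ (e * (k == j.+1)) = zvar k ^+ e :> R.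
Proof.
case: k => // k _ /orP[lt_k|/eqP ->]; last first.
  by rewrite expr0 big1.
rewrite (bigD1 (Ordinal lt_k)) //= eqxx muln1 big1 ?mulr1 => [|j neq_j].
  by rewrite -[k.+1]/((Ordinal lt_k).+1) zvarS.
by rewrite eqSS (_ : k == j = false) ?muln0 //; apply/negbTE; rewrite eq_sym.
Qed.

Lemma prod_zweight n (w : {ffun 'I_n -> 'I_q}) : (n <= N)%N ->
  \prod_(j < N) 'X_j ^+ ncycles (deck_perm w) j.+1 =
  \prod_(C in orbs) orb_zweight C (mult K N w C) :> R.
Proof.
move=> le_n.
rewrite (eq_bigr (fun j : 'I_N => \prod_(C in orbs)
    'X_j ^+ orb_cycles C (mult K N w C) j.+1)); last first.
  by move=> j _; rewrite (mult_ncycles le_n K_dvd) // expr_sum.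
rewrite exchange_big /=; apply: eq_bigr => C Co.
have C_gt0 := orbs_gt0 Co; have le_C : (#|C| <= N)%N by case/setIdP: Co.
rewrite /orb_cycles /orb_zweight; case: orb_odd; last first.
  by rewrite prod_zvar ?le_C.
rewrite (eq_bigr _ (fun j _ => exprD _ _ _)) big_split /= !prod_zvar ?le_C ?double_gt0 //.
(* Double covers need multiplicity at least [2], and then [2 * #|C| <= n <= N], so their variable is
   among the available ones. *)
have [_|c_neq0] := eqVneq (mult K N w C)./2 0%N; first by rewrite orbT.
have : (#|C| * mult K N w C <= n)%N.
  rewrite -[X in (_ <= X)%N](mult_weight le_n K_dvd w).
  by rewrite [X in (_ <= X)%N](bigD1 C) //= leq_addr.
have c_ge2 : (1 < mult K N w C)%N.
  by move: c_neq0; case: (nat_of_ord (mult K N w C)) => [|[]].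
move=> le_kc; rewrite orbF -(muln2 #|C|) (leq_trans _ le_n) // (leq_trans _ le_kc) //.
by rewrite leq_mul2l c_ge2 orbT.
Qed.

(** [mult] is a bijection from words of length [n] to multisets of necklaces of weight [n]. *)
Lemma coef_prod_words n : (n <= N)%N ->
  (\prod_(C in orbs) orb_factor C)`_n =
  \sum_(w : {ffun 'I_n -> 'I_q})
     (q%:R : rat) ^- n *: \prod_(j < N) 'X_j ^+ ncycles (deck_perm w) j.+1.
Proof.
move=> le_n; rewrite coef_prod_orbs //.
rewrite [RHS](eq_bigr (fun w => (q%:R : rat) ^- n *:
   \prod_(C in orbs) orb_zweight C (mult K N w C))); last first.
  by move=> w _; rewrite prod_zweight.
pose F (f : {ffun {set X} -> 'I_N.+1}) :=
  (q%:R : rat) ^- n *: \prod_(C in orbs) orb_zweight C (f C).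
rewrite -[RHS](big_imset F (A := predT) (h := fun w => mult K N w)); last first.
  by move=> w w' _ _; apply: (mult_inj le_n K_dvd).
apply: eq_bigl => f.
apply/andP/imsetP => [[/pffun_onP[/supportP f_supp _] /eqP wf]|[w _ ->]].
  by have [w <-] := mult_surj le_n K_dvd f_supp wf; exists w.
split; last by rewrite /weight (mult_weight le_n K_dvd).
apply/pffun_onP; split=> //; apply/supportP => C; exact: mult_supp.
Qed.

Definition cycle_sum n : R :=
  \sum_(pi : 'S_n) (xm m pi)%:MP * \prod_(k < N) 'X_k ^+ ncycles pi k.+1.

(** Each word of choices has probability [q ^- n]; words are grouped by the deck permutation they
    produce. *)
Lemma cycle_sumE n : cycle_sum n =
  \sum_(w : {ffun 'I_n -> 'I_q})
     (q%:R : rat) ^- n *: \prod_(j < N) 'X_j ^+ ncycles (deck_perm w) j.+1.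
Proof.
rewrite /cycle_sum [RHS](partition_big (@deck_perm n m) predT) //=.
apply: eq_bigr => pi _; rewrite [RHS](eq_bigr (fun=> (q%:R : rat) ^- n *:
   \prod_(k < N) 'X_k ^+ ncycles pi k.+1)) => [|w /eqP -> //].
rewrite sumr_const mul_mpolyC -scaler_nat scalerA; congr (_ *: _).
rewrite /xm natrX; congr (_%:R / _); apply: eq_card => w.
by rewrite !inE deck_permP eq_sym.
Qed.

Lemma lhs_coef i : (i <= N)%N -> (lhs_tr N m)`_i = cycle_sum i.
Proof.
(* The separate constant term of [lhs_tr] is the summand for [n = 0]: the empty permutation has no
   cycles. *)
move=> le_i; have cyc0 : cycle_sum 0 = 1.
  rewrite cycle_sumE expr0 invr1 (eq_bigr (fun=> 1)) => [|w _].
    by rewrite sumr_const card_ffun !card_ord expn0.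
  rewrite scale1r big1 // => j _; rewrite (_ : ncycles _ _ = 0%N) ?expr0 //.
  by apply/eqP; rewrite cards_eq0; apply/eqP/setP => C; rewrite !inE;
     apply/negP => /andP[/imsetP[[]]].
have -> : lhs_tr N m = \sum_(0 <= n < N.+1) mono (cycle_sum n) n.
  rewrite big_ltn // cyc0 mono1; congr (_ + _).
  by apply: eq_bigr => n _; rewrite /mono mulrC.
rewrite coef_sum big_mkord (bigD1 (Ordinal (le_i : (i < N.+1)%N))) //= coef_mono eqxx.
rewrite big1 ?addr0 // => j neq_j; rewrite coef_mono ifN //.
Qed.

Lemma prod_orbs_card :
  \prod_(C in orbs) orb_factor C =
  \prod_(1 <= k < N.+1) ((1 + avar k) ^+ num_odd m K k *
     geom N (avar k.*2) ^+ num_odd m K k * geom N (avar k) ^+ num_even m K k).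
Proof.
transitivity (\prod_(1 <= k < N.+1) \prod_(C in porbits sh | #|C| == k) orb_factor C).
  rewrite big_add1 /= big_mkord.
  rewrite (exchange_big_dep (mem orbs)) /=; last first.
    by move=> k C _ /andP[Cs /eqP eq_C]; rewrite inE Cs eq_C ltn_ord.
  apply: eq_bigr => C Co; have C_gt0 := orbs_gt0 Co.
  case/setIdP: Co => Cs le_C; have lt_C : (#|C|.-1 < N)%N by lia.
  rewrite (big_pred1 (Ordinal lt_C)) // => k.
  rewrite Cs /=; apply/eqP/eqP => [eq_C|->]; last by rewrite /= (prednK C_gt0).
  by apply/val_inj; rewrite /= eq_C.
apply: eq_bigr => k _; rewrite (bigID (@orb_odd _ _)) /= -exprMn; congr (_ * _).
  rewrite (eq_bigr (fun=> (1 + avar k) * geom N (avar k.*2))); last first.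
    by move=> C /andP[/andP[_ /eqP <-] odd_C]; rewrite /orb_factor odd_C.
  rewrite (eq_bigl (mem [set C in porbits sh | (#|C| == k) && orb_odd C])).
    by rewrite prodr_const.
  by move=> C; rewrite /= inE andbA.
rewrite (eq_bigr (fun=> geom N (avar k))); last first.
  by move=> C /andP[/andP[_ /eqP <-] /negbTE even_C]; rewrite /orb_factor even_C.
rewrite (eq_bigl (mem [set C in porbits sh | (#|C| == k) && ~~ orb_odd C])).
  by rewrite prodr_const.
by move=> C; rewrite /= inE andbA.
Qed.

(** Doubling is reindexed to even lengths; lengths beyond [N] give the factor [1] since their
    variable is [0]. *)
Lemma prod_geom_double :
  \prod_(1 <= k < N.+1) geom N (avar k.*2) ^+ num_odd m K k =
  \prod_(1 <= k < N.+1) geom N (avar k) ^+ (if odd k then 0 else num_odd m K k./2)%N.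
Proof.
pose H k := geom N (avar k) ^+ num_odd m K k./2.
rewrite (eq_bigr (fun k => H k.*2)) => [|k _]; last by rewrite /H doubleK.
rewrite prod_double (big_cat_nat (n := N.+1)) //=; last by lia.
rewrite [X in _ * X]big_nat_cond [X in _ * X]big1 ?mulr1 => [|k]; last first.
  by move=> /andP[/andP[gtN _] _]; rewrite /H geom_avar ?expr1n.
by rewrite big_mkcond; apply: eq_bigr => k _; rewrite /H; case: odd.
Qed.

(** By [num_oddP] both sides share the powers of [1 + a_k]. The exponents of [geom N (avar k)] then
    agree by [num_evenP], whose term [k == 1] matches the separate factor in [z_1]. *)
Lemma rhs_eq_trunc :
  eq_trunc N ((\prod_(k < N | val k == 0%N) geom_tr (aterm m k)) *
     \prod_(k < N) ratpow_tr (fim k.+1 m) (aterm m k))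
    (\prod_(C in orbs) orb_factor C).
Proof.
apply: (@eq_trunc_trans _ _ ((\prod_(k < N | val k == 0%N) geom N (avar k.+1)) *
   \prod_(k < N) ((1 + avar k.+1) ^+ num_odd m K k.+1 *
                  geom N (avar k.+1) ^+ num_odd m K k.+1))).
  apply: eq_truncM; apply: eq_trunc_prod => k _; rewrite atermE //.
  rewrite (@num_oddP m K) //; last by apply: K_dvd; have := ltn_ord k; lia.
  exact/ratpow_trP/avar_nil.
have toN (F : nat -> {poly R}) : \prod_(k < N) F k.+1 = \prod_(1 <= k < N.+1) F k.
  by rewrite big_add1 big_mkord.
rewrite big_mkcond big_split /= mulrCA.
rewrite (toN (fun k => (1 + avar k) ^+ num_odd m K k)) -big_split /=.
rewrite (toN (fun k => (if k.-1 == 0%N then geom N (avar k) else 1) *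
   geom N (avar k) ^+ num_odd m K k)).
have -> : \prod_(C in orbs) orb_factor C =
    (\prod_(1 <= k < N.+1) (1 + avar k) ^+ num_odd m K k) *
    \prod_(1 <= k < N.+1)
      (geom N (avar k) ^+ (if odd k then 0 else num_odd m K k./2)%N *
       geom N (avar k) ^+ num_even m K k).
  by rewrite prod_orbs_card !big_split /= prod_geom_double -mulrA.
apply: eq_truncM; first exact: eq_trunc_refl.
suff -> : \prod_(1 <= k < N.+1) ((if k.-1 == 0%N then geom N (avar k) else 1) *
      geom N (avar k) ^+ num_odd m K k) =
    \prod_(1 <= k < N.+1)
      (geom N (avar k) ^+ (if odd k then 0 else num_odd m K k./2)%N *
       geom N (avar k) ^+ num_even m K k) by exact: eq_trunc_refl.
rewrite big_nat [RHS]big_nat; apply: eq_bigr => k /andP[k_gt0 le_k].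
rewrite -exprD addnC num_evenP //; last by apply: K_dvd; lia.
rewrite addnC exprD; congr (_ * _).
by case: k k_gt0 le_k => [|[|k]] //=; rewrite ?expr1 ?expr0.
Qed.

End CycleSeries.

(* For every m >= 1 and every truncation order N, the two formal power series
   agree modulo u^(N+1) (in the variables u, z_1, ..., z_N). *)
Theorem theorem5p1 (m : nat) (hm : (0 < m)%N) (N : nat) :
  take_poly N.+1 (lhs_tr N m) = rhs_tr N m.
Proof.
apply: eq_trunc_take => i le_i; rewrite rhs_eq_trunc // lhs_coef //.
by rewrite cycle_sumE coef_prod_words.
Qed.
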